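(* Let $X$ be a locally compact and $\sigma$-compact space and let $\mathcal{A}=((a_{N,n})_{N\in\mathbb{N}})_{n\in\mathbb{N}}$ be a double sequence of weights on $X$ with $a_{N,n+1}\le a_{N,n}\le a_{N+1,n}$ for all $N,n$. The following conditions are equivalent: (i) $\mathcal{A}$ satisfies condition (wQ), i.e. $$\forall N\;\exists M,n\;\forall K,m\;\exists k,\,S>0:\quad \frac{1}{a_{M,m}}\le\max\Big(\frac{S}{a_{N,n}},\frac{S}{a_{K,k}}\Big)\ \text{ on } X.$$ (ii) $(AC)_c(X)$ is bornological. (iii) $(AC)_0(X)$ is barrelled.
   Context: Topological spaces are Hausdorff; indices range over $\mathbb{N}$. A weight on $X$ is a strictly positive continuous function on $X$. $C(X)$ (resp. $C_c(X)$) is the space of all continuous scalar functions on $X$ (resp. those with compact support). For a weight $a$ put $\|f\|_a=\sup_{x\in X}a(x)|f(x)|$ and $Ca_0(X)=\{f\in C(X): a|f|\text{ vanishes at }\infty\text{ on }X\}$, normed by $\|\cdot\|_a$; here $g$ vanishes at $\infty$ on $X$ if for each $\epsilon>0$ there is a compact $K\subseteq X$ with $|g(x)|<\epsilon$ for $x\in X\setminus K$. Define $(AC)_0(X)=\operatorname{proj}_N\operatorname{ind}_n C(a_{N,n})_0(X)$ and $(AC)_c(X)=\operatorname{proj}_N\operatorname{ind}_n C(a_{N,n})_c(X)$, where $C(a_{N,n})_c(X)$ is $C_c(X)$ endowed with the norm $\|\cdot\|_{a_{N,n}}$. Here $\operatorname{ind}_n$ is the union of the spaces with the locally convex inductive limit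 topology, and $\operatorname{proj}_N$ is the intersection with the initial topology with respect to the inclusions. *)

(* Defs.v *)
From HB Require Import structures.
From mathcomp Require Import all_boot all_order all_algebra complex.
From mathcomp Require Import all_classical all_reals all_analysis.

Set Implicit Arguments.
Unset Strict Implicit.
Unset Printing Implicit Defensive.

Import Order.TTheory GRing.Theory Num.Theory.
Import numFieldNormedType.Exports.

Local Open Scope classical_set_scope.
Local Open Scope ring_scope.

Section BarrelledBornological.
Context {K : numFieldType} {E : tvsType K}.
Implicit Types U B : set E.

Definition balanced U := forall (k : K) x, `|k| <= 1 -> U x -> U (k *: x).

Definition absolutely_convex U := convex_set U /\ balanced U.

(* U absorbs B when B is contained in k U for all scalars k large enough. *)
Definition absorbs U B :=
  exists2 r : K, 0 < r & forall k : K, r <= `|k| -> B `<=` *:%R k @` U.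

(* Boundedness in the sense of topological vector spaces, not of a metric. *)
Definition tvs_bounded B := forall U, nbhs 0 U -> absorbs U B.

Definition bornivorous U := forall B, tvs_bounded B -> absorbs U B.

Definition absorbing U := forall x, absorbs U [set x].

Definition barrel U := [/\ closed U, absolutely_convex U & absorbing U].

End BarrelledBornological.

Definition bornological (K : numFieldType) (E : tvsType K) :=
  forall U : set E, absolutely_convex U -> bornivorous U -> nbhs 0 U.

Definition barrelled (K : numFieldType) (E : tvsType K) :=
  forall U : set E, barrel U -> nbhs 0 U.

(* The finest locally convex topology requires quantifying over the topologies
   of a fixed vector space, whose algebraic structure must not vary: hence the
   topology is a value here, and topologized turns it into an instance. *)
Record topology_on (T : Type) := TopologyOn {
  opens : set_system T ;
  opensT : opens setT ;
  opensI : setI_closed opens ;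
  opens_bigcup : forall F : set_system T,
    F `<=` opens -> opens (\bigcup_(A in F) A) }.

Definition topologized (T : Type) (t : topology_on T) : Type := T.

Section Topologized.
Context (T : choiceType) (t : topology_on T).

Lemma opens_bigcupT (I : Type) (f : I -> set T) :
  (forall i, opens t (f i)) -> opens t (\bigcup_i f i).
Proof.
move=> fo; have -> : \bigcup_i f i = \bigcup_(A in range f) A.
  by rewrite bigcup_image.
by apply: opens_bigcup => _ [i _ <-].
Qed.

HB.instance Definition _ := Choice.on (topologized t).
HB.instance Definition _ := isOpenTopological.Build (topologized t)
  (@opensT _ t) (@opensI _ t) opens_bigcupT.

End Topologized.

HB.instance Definition _ (K : numDomainType) (E : lmodType K)
  (t : topology_on E) := GRing.Lmodule.on (topologized t).

Section TopologyOf.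
Context (T : topologicalType).

Lemma open_bigcup_set (F : set_system T) :
  F `<=` open -> open (\bigcup_(A in F) A).
Proof. by move=> Fo; apply: bigcup_open. Qed.

Definition topology_of : topology_on T :=
  TopologyOn (@openT T) (@openI T) open_bigcup_set.

Lemma nbhs_topology_of (x : T) :
  nbhs (x : topologized topology_of) = nbhs x.
Proof. by rewrite [RHS]nbhsE [LHS]nbhsE. Qed.

End TopologyOf.

Section LocallyConvexTopology.
Context {K : numFieldType} {E : lmodType K}.

Definition is_locally_convex (t : topology_on E) :=
  let T := topologized t in
  [/\ continuous (fun z : T * T => z.1 + z.2 : T),
      continuous (fun z : K^o * T => z.1 *: z.2 : T) &
      exists2 B : set_system T, (forall b, b \in B -> convex_set b) & basis B].

End LocallyConvexTopology.

Lemma topology_of_locally_convex (K : numFieldType) (E : tvsType K) :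
  is_locally_convex (topology_of E).
Proof.
split.
- move=> z A; rewrite nbhs_topology_of => /(@add_continuous E z) [[P Q] /= [zP zQ] PQA].
  by exists (P, Q) => //=; rewrite !nbhs_topology_of.
- move=> z A; rewrite nbhs_topology_of => /(@scale_continuous K E z) [[P Q] /= [zP zQ] PQA].
  by exists (P, Q) => //=; rewrite nbhs_topology_of.
- have [B cB [Bo Bb]] := @locally_convex K E; exists B => //.
  by split => // x A; rewrite nbhs_topology_of => /Bb.
Qed.

Definition sup_topology_on (T : choiceType) (J : Type) (t : J -> topology_on T) :
    topology_on T :=
  topology_of (sup_topology (fun j => Topological.on (topologized (t j)))).

Lemma cvg_sup_topology_on (T : choiceType) (J : Type) (t : J -> topology_on T)
    (F : set_system T) (x : T) : Filter F ->
  F --> (x : topologized (sup_topology_on t)) <->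
  forall j, F --> (x : topologized (t j)).
Proof.
by move=> FF; rewrite nbhs_topology_of; exact: cvg_sup.
Qed.

Lemma sup_locally_convex (K : numFieldType) (E : lmodType K) (J : Type)
    (t : J -> topology_on E) :
  (forall j, is_locally_convex (t j)) -> is_locally_convex (sup_topology_on t).
Proof.
move=> lct; pose T := topologized (sup_topology_on t).
have cvgj j (x : T) : nbhs x --> (x : topologized (t j)).
  move: j; apply: (iffLR (@cvg_sup_topology_on E J t (nbhs x) x _)).
  exact: cvg_id.
split.
- move=> z; apply/(@cvg_sup_topology_on E J t) => j A.
  have [addc _ _] := lct j.
  move=> zA; have [[P Q] /= [zP zQ] PQA] := addc z A zA.
  by exists (P, Q) => //=; split; [exact: (cvgj j _ P zP)|exact: (cvgj j _ Q zQ)].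
- move=> z; apply/(@cvg_sup_topology_on E J t) => j A.
  have [_ scalec _] := lct j.
  move=> zA; have [[P Q] /= [zP zQ] PQA] := scalec z A zA.
  by exists (P, Q) => //=; split=> //; exact: (cvgj j _ Q zQ).
- exists [set b : set T | open b /\ convex_set (b : set E)].
    by move=> b; rewrite inE => -[].
  split=> [b []//|x].
  have FF : Filter (filter_from
      [set U | [set b : set T | open b /\ convex_set (b : set E)] U /\ U x] id).
    apply: filter_from_filter.
      exists setT; split=> //; split; first exact: openT.
      by move=> *; rewrite inE.
    move=> U V [[oU cU] Ux] [[oV cV] Vx]; exists (U `&` V) => //.
    split=> //; split; first exact: openI.
    move=> y z l; rewrite !inE => -[Uy Vy] [Uz Vz].
    by split; apply/set_mem; [apply: cU|apply: cV]; exact/mem_set.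
  apply/(@cvg_sup_topology_on E J t) => j A.
  have [_ _ [B cB [Bo Bb]]] := lct j.
  move=> /Bb [b [Bb' bx] bA]; exists b => //; split=> //; split.
    rewrite openE => y by'; apply: (cvgj j y b).
    by apply: open_nbhs_nbhs; split => //; exact: Bo.
  by apply: cB; exact/mem_set.
Qed.

(* The finest locally convex topology making all the f i continuous is the
   supremum of the locally convex topologies that make all the f i continuous. *)
Section FinestLocallyConvex.
Context {K : numFieldType} {E : lmodType K} {I : Type} {F : I -> topologicalType}.
Variable f : forall i, F i -> E.

Definition lc_admissible (t : topology_on E) :=
  is_locally_convex t /\ forall i, continuous (@f i : F i -> topologized t).

Definition finest_locally_convex : topology_on E :=
  sup_topology_on (fun t : {t | lc_admissible t} => sval t).

Lemma finest_locally_convexP : is_locally_convex finest_locally_convex.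
Proof. by apply: sup_locally_convex => -[t []]. Qed.

End FinestLocallyConvex.

Record lin_subspace (K : numFieldType) (V : lmodType K) := LinSubspace {
  lin_carrier :> set V ;
  lin_closed0 : lin_carrier 0 ;
  lin_closedP : forall (a : K) u v,
    lin_carrier u -> lin_carrier v -> lin_carrier (a *: u + v) }.

Section LinSubspaceType.
Context {K : numFieldType} {V : lmodType K} (U : lin_subspace V).

Definition in_lin : {pred V} := mem (lin_carrier U).

Lemma in_lin_submod_closed : submod_closed in_lin.
Proof.
split; first by apply/mem_set; exact: lin_closed0.
by move=> a u v /set_mem Uu /set_mem Uv; apply/mem_set; exact: lin_closedP.
Qed.

HB.instance Definition _ := GRing.isSubmodClosed.Build K V in_lin in_lin_submod_closed.

Definition lin_sort := {v : V | v \in in_lin}.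

HB.instance Definition _ := SubChoice.on lin_sort.
HB.instance Definition _ := [SubChoice_isSubLmodule of lin_sort by <:].

Definition lin_mk (v : V) (Uv : lin_carrier U v) : lin_sort := exist _ v (mem_set Uv).

Lemma lin_valP (v : lin_sort) : lin_carrier U (val v).
Proof. by apply/set_mem; exact: (valP v). Qed.

End LinSubspaceType.

Record lc_topology (K : numFieldType) (E : lmodType K) := LcTopology {
  lc_opens :> topology_on E ;
  lc_axiom : is_locally_convex lc_opens }.

Definition lc_topologized (K : numFieldType) (E : lmodType K)
  (t : lc_topology E) : Type := topologized t.

Section LcTopologized.
Context {K : numFieldType} {E : lmodType K} (t : lc_topology E).
Local Notation T := (lc_topologized t).

HB.instance Definition _ := PreTopologicalLmodule.copy T (topologized t).

Let lc_add_continuous : continuous (fun z : T * T => z.1 + z.2).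
Proof. by have [] := lc_axiom t. Qed.

Let lc_scale_continuous : continuous (fun z : K^o * T => z.1 *: z.2).
Proof. by have [] := lc_axiom t. Qed.

Let lc_convex_basis :
  exists2 B : set_system T, (forall b, b \in B -> convex_set b) & basis B.
Proof. by have [] := lc_axiom t. Qed.

(* This factory only provides the uniform structure. *)
HB.instance Definition _ := PreTopologicalLmod_isTvs.Build K T
  lc_add_continuous lc_scale_continuous lc_convex_basis.

HB.instance Definition _ :=
  PreTopologicalNmodule_isTopologicalNmodule.Build T lc_add_continuous.
HB.instance Definition _ :=
  TopologicalNmodule_isTopologicalLmodule.Build K T lc_scale_continuous.
HB.instance Definition _ := Uniform_isTvs.Build K T lc_convex_basis.

End LcTopologized.

(* A linear subspace of V with a locally convex topology of its own, in general
   not the one induced by a topology of V. *)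
Record lcs (K : numFieldType) (V : lmodType K) := LCS {
  lcs_space : lin_subspace V ;
  lcs_topology : lc_topology (lin_sort lcs_space) }.

Definition lcs_set (K : numFieldType) (V : lmodType K) (E : lcs V) : set V :=
  lin_carrier (lcs_space E).

Definition lcs_tvs (K : numFieldType) (V : lmodType K) (E : lcs V) : tvsType K :=
  lc_topologized (lcs_topology E).

Section InitialTopology.
Context {K : numFieldType} {E : lmodType K} {F : tvsType K}.
Variable f : E -> F.
Hypothesis f_linear : linear f.

Lemma initial_locally_convex : is_locally_convex (topology_of (initial_topology f)).
Proof.
have fD x y : f (x + y) = f x + f y.
  by have := f_linear 1 x y; rewrite !scale1r.
have f0 : f 0 = 0.
  by have := f_linear (-1) 0 0; rewrite scaler0 addr0 scaleN1r addNr.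
have fZ k x : f (k *: x) = k *: f x by have := f_linear k x 0; rewrite f0 !addr0.
pose T := topologized (topology_of (initial_topology f)).
have nbhsf (x : T) A : nbhs (f x) A -> nbhs x (f @^-1` A).
  by rewrite nbhs_topology_of => fxA; exact: (@initial_continuous E F f x A).
have nbhsI (x : T) A : nbhs x A -> exists2 B, nbhs (f x) B & f @^-1` B `<=` A.
  rewrite nbhs_topology_of => -[_ [[B oB <-] Bx BA]].
  by exists B => //; exact: open_nbhs_nbhs.
split.
- move=> z A /nbhsI [B]; rewrite fD => /(@add_continuous F (f z.1, f z.2)).
  move=> [[P Q] /= [zP zQ] PQB] BA.
  exists (f @^-1` P, f @^-1` Q); first by split; exact: nbhsf.
  move=> [x y] /= [Px Qy]; apply: BA; rewrite /= fD.
  exact: (PQB (f x, f y)).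
- move=> z A /nbhsI [B]; rewrite fZ => /(@scale_continuous K F (z.1, f z.2)).
  move=> [[P Q] /= [zP zQ] PQB] BA.
  exists (P, f @^-1` Q); first by split=> //; exact: nbhsf.
  move=> [x y] /= [Px Qy]; apply: BA; rewrite /= fZ.
  exact: (PQB (x, f y)).
- have [B cB [Bo Bb]] := @locally_convex K F.
  exists [set b : set T | exists2 c, B c & b = f @^-1` c].
    move=> b; rewrite inE => -[c Bc ->] x y l; rewrite !inE /= => cx cy.
    have := cB c (mem_set Bc) (f x) (f y) l (mem_set cx) (mem_set cy).
    by rewrite inE /conv /= fD !fZ.
  split=> [_ [c Bc ->]|x A /nbhsI [C /Bb [c [Bc cx] cC] CA]].
    by exists c => //; exact: Bo.
  exists (f @^-1` c); first by split=> //; exists c.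
  by move=> y /cC /CA.
Qed.

End InitialTopology.

Section InductiveLimit.
Context {K : numFieldType} {V : lmodType K} (E : nat -> lcs V).
Hypothesis E_incr : forall n, lcs_set (E n) `<=` lcs_set (E n.+1).

Lemma ind_incr m n : (m <= n)%N -> lcs_set (E m) `<=` lcs_set (E n).
Proof.
move=> /subnK <-; elim: (n - m)%N => [//|k IH] v /IH; exact: E_incr.
Qed.

Lemma ind_closed0 : (\bigcup_n lcs_set (E n)) 0.
Proof. by exists 0%N => //; exact: lin_closed0. Qed.

Lemma ind_closedP (a : K) u v : (\bigcup_n lcs_set (E n)) u ->
  (\bigcup_n lcs_set (E n)) v -> (\bigcup_n lcs_set (E n)) (a *: u + v).
Proof.
move=> [m _ Eu] [n _ Ev]; exists (maxn m n) => //; apply: lin_closedP.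
- exact: (ind_incr (leq_maxl m n) Eu).
- exact: (ind_incr (leq_maxr m n) Ev).
Qed.

Definition ind_space : lin_subspace V := LinSubspace ind_closed0 ind_closedP.

Lemma ind_sub n (v : lin_sort (lcs_space (E n))) : lin_carrier ind_space (val v).
Proof. by exists n => //; exact: lin_valP. Qed.

Definition ind_incl n (v : lcs_tvs (E n)) : lin_sort ind_space :=
  lin_mk (ind_sub v).

Definition ind_lim : lcs V := LCS (LcTopology (finest_locally_convexP ind_incl)).

End InductiveLimit.

Section ProjectiveLimit.
Context {K : numFieldType} {V : lmodType K} (E : nat -> lcs V).

Lemma proj_closed0 : (\bigcap_n lcs_set (E n)) 0.
Proof. by move=> n _; exact: lin_closed0. Qed.

Lemma proj_closedP (a : K) u v : (\bigcap_n lcs_set (E n)) u ->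
  (\bigcap_n lcs_set (E n)) v -> (\bigcap_n lcs_set (E n)) (a *: u + v).
Proof.
by move=> Eu Ev n _; apply: lin_closedP; [exact: Eu|exact: Ev].
Qed.

Definition proj_space : lin_subspace V := LinSubspace proj_closed0 proj_closedP.

Lemma proj_sub n (v : lin_sort proj_space) : lin_carrier (lcs_space (E n)) (val v).
Proof. exact: (lin_valP v). Qed.

Definition proj_incl n (v : lin_sort proj_space) : lcs_tvs (E n) :=
  lin_mk (proj_sub n v).

Lemma proj_incl_linear n : linear (@proj_incl n).
Proof. by move=> a u v; apply: val_inj. Qed.

Definition proj_topology : topology_on (lin_sort proj_space) :=
  sup_topology_on (fun n => topology_of (initial_topology (@proj_incl n))).

Lemma proj_locally_convex : is_locally_convex proj_topology.
Proof.
apply: sup_locally_convex => n.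
exact: (initial_locally_convex (@proj_incl_linear n)).
Qed.

Definition proj_lim : lcs V := LCS (LcTopology proj_locally_convex).

End ProjectiveLimit.

(* "Scalar functions" are either all real-valued or all complex-valued. *)
Variant scalars := real_scalars | complex_scalars.

Definition scalar_field (R : realType) (s : scalars) : numFieldType :=
  match s with real_scalars => R | complex_scalars => R[i] end.

Definition of_real (R : realType) (s : scalars) : R -> scalar_field R s :=
  match s with
  | real_scalars => id
  | complex_scalars => fun x => (x%:C)%C
  end.

(* The absolute value of a scalar as a real number; the library norm `|z| of
   z : R[i] is this real number injected in R[i]. *)
Definition modulus (R : realType) (s : scalars) : scalar_field R s -> R :=
  match s with
  | real_scalars => fun x => `|x|
  | complex_scalars => fun z => Normc.normc z
  end.

Section Modulus.
Context {R : realType} {s : scalars}.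
Local Notation K := (scalar_field R s).

Lemma of_real_modulus (z : K) : of_real s (modulus z) = `|z|.
Proof. by case: s z. Qed.

Lemma of_realD : {morph of_real s : x y / x + y :> R >-> x + y}.
Proof. by case: s => //= x y; rewrite rmorphD. Qed.

Lemma of_realM : {morph of_real s : x y / x * y :> R >-> x * y}.
Proof. by case: s => //= x y; rewrite rmorphM. Qed.

Lemma of_real_le : {mono of_real s : x y / x <= y :> R >-> x <= y}.
Proof. by case: s => //= x y; rewrite lecR. Qed.

Lemma of_real0 : of_real s (0 : R) = 0.
Proof. by case: s. Qed.

Lemma of_real_inj : injective (of_real s : R -> K).
Proof. by case: s => //= x y []. Qed.

Lemma of_real_lt : {mono of_real s : x y / x < y :> R >-> x < y}.
Proof. by case: s => //= x y; rewrite ltcR. Qed.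

Lemma modulus_ge0 (z : K) : 0 <= modulus z.
Proof. by rewrite -of_real_le of_real_modulus of_real0. Qed.

Lemma modulusD (z w : K) : modulus (z + w) <= modulus z + modulus w.
Proof. by rewrite -of_real_le of_realD !of_real_modulus ler_normD. Qed.

Lemma modulusM (z w : K) : modulus (z * w) = modulus z * modulus w.
Proof. by apply: of_real_inj; rewrite of_realM !of_real_modulus normrM. Qed.

Lemma modulus0_eq0 (z : K) : modulus z = 0 -> z = 0.
Proof. by move=> z0; apply/normr0_eq0; rewrite -of_real_modulus z0 of_real0. Qed.

Lemma modulus0 : modulus (0 : K) = 0.
Proof. by apply: of_real_inj; rewrite of_real_modulus of_real0 normr0. Qed.

End Modulus.

Definition sigma_compact (X : topologicalType) :=
  exists C : nat -> set X, (forall n, compact (C n)) /\ \bigcup_n C n = setT.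

Record weight (R : realType) (X : topologicalType) := Weight {
  weight_fun :> X -> R ;
  weight_continuous : continuous weight_fun ;
  weight_gt0 : forall x, 0 < weight_fun x }.

Definition vanishes_at_infinity (R : realType) (X : topologicalType) (g : X -> R) :=
  forall e : R, 0 < e ->
    exists2 C : set X, compact C & forall x, ~ C x -> `|g x| < e.

Section WeightedSpaces.
Context {R : realType} {X : topologicalType} (s : scalars).
Local Notation K := (scalar_field R s).
Local Notation V := (X -> K^o).
Implicit Types (a : weight R X) (f : V).

Definition weighted a f : X -> R := fun x => a x * modulus (f x).

Definition weighted_norm a f : R := sup (range (weighted a f)).

Definition C0_set a : set V :=
  [set f | continuous (f : X -> K) /\ vanishes_at_infinity (weighted a f)].

Definition Cc_set : set V :=
  [set f | continuous (f : X -> K) /\ compact (closure [set x | f x != 0])].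

Lemma weighted_ge0 a f x : 0 <= weighted a f x.
Proof. by rewrite mulr_ge0 ?modulus_ge0// ltW// weight_gt0. Qed.

Lemma weightedD a f g x : weighted a (f + g) x <= weighted a f x + weighted a g x.
Proof. by rewrite -mulrDr ler_wpM2l ?modulusD// ltW// weight_gt0. Qed.

Lemma weightedZ a (k : K) f x : weighted a (k *: f) x = modulus k * weighted a f x.
Proof. by rewrite /weighted modulusM mulrCA. Qed.

Lemma continuous_lin (k : K) f g : continuous (f : X -> K) ->
  continuous (g : X -> K) -> continuous (k *: f + g : X -> K).
Proof.
move=> fc gc x.
change ((fun y => k * f y + g y) y @[y --> x] --> k * f x + g x).
by apply: cvgD; [apply: cvgM; [exact: cvg_cst|exact: fc]|exact: gc].
Qed.

Lemma modulus_continuous : continuous (@modulus R s).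
Proof.
move=> z.
have FF : Filter (nbhs z) := nbhs_filter z.
have zK : (id : K -> K) w @[w --> z] --> z by exact: cvg_id.
apply/cvgrPdist_lt => e e0.
have e0' : 0 < of_real s e by rewrite -of_real0 of_real_lt.
have modB (u v : K) : modulus u - modulus v <= modulus (u - v).
  by rewrite lerBlDr (le_trans _ (modulusD _ _))// subrK.
have modN (u v : K) : modulus (u - v) = modulus (v - u).
  by apply: (@of_real_inj R s); rewrite !of_real_modulus distrC.
near=> w; apply: (@le_lt_trans _ _ (modulus (z - w))).
  by rewrite ler_norml modB andbT lerNl opprB (modN z) modB.
rewrite -(@of_real_lt R s); rewrite of_real_modulus.
by near: w; move: (of_real s e) e0'; apply/cvgrPdist_lt.
Unshelve. all: by end_near. Qed.

Lemma weighted_continuous a f : continuous (f : X -> K) -> continuous (weighted a f).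
Proof.
move=> fc x; apply: cvgM; first exact: weight_continuous.
by apply: continuous_cvg; [exact: modulus_continuous|exact: fc].
Qed.

Lemma Cc_subC0 a : Cc_set `<=` C0_set a.
Proof.
move=> f [fc fK]; split=> // e e0; exists (closure [set x | f x != 0]) => // x nfx.
have -> : weighted a f x = 0; last by rewrite normr0.
have [fx0|fx0] := eqVneq (f x) 0; last by case: nfx; exact: subset_closure.
by rewrite /weighted fx0 modulus0 mulr0.
Qed.

Lemma C0_bounded a f : C0_set a f -> has_ubound (range (weighted a f)).
Proof.
move=> [fc fv]; have [C cC Cf] := fv 1 ltr01.
have [M [_ Mf]] : bounded_set (weighted a f @` C).
  apply: compact_bounded; apply: continuous_compact => //.
  by apply: continuous_subspaceT; exact: weighted_continuous.
exists (Num.max 1 (M + 1)) => _ [x _ <-]; rewrite le_max.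
have [Cx|/Cf fx1] := pselect (C x).
  apply/orP; right; apply: (le_trans (ler_norm _)).
  by apply: (Mf (M + 1)); [rewrite ltrDl|exists x].
by rewrite (le_trans (ler_norm _) (ltW fx1)).
Qed.

Lemma C0_closed0 a : C0_set a 0.
Proof.
split; first exact: cst_continuous.
move=> e e0; exists set0 => [|x _]; first exact: compact0.
by rewrite /weighted modulus0 mulr0 normr0.
Qed.

Lemma C0_closedP a (k : K) f g :
  C0_set a f -> C0_set a g -> C0_set a (k *: f + g).
Proof.
move=> [fc fv] [gc gv]; split; first exact: continuous_lin.
have k1 : 0 < modulus k + 1 by rewrite ltr_wpDl ?modulus_ge0.
move=> e e0; have e2 : 0 < e / 2 by rewrite divr_gt0.
have [C cC Cf] := fv _ (divr_gt0 e2 k1); have [D cD Dg] := gv _ e2.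
exists (C `|` D) => [|x /not_orP[/Cf fx /Dg gx]]; first exact: compactU.
rewrite ger0_norm ?weighted_ge0// in fx; rewrite ger0_norm ?weighted_ge0// in gx.
rewrite ger0_norm ?weighted_ge0// (le_lt_trans (weightedD _ _ _ _))//.
rewrite (splitr e) ltrD// weightedZ.
rewrite ltr_pdivlMr// in fx; rewrite (le_lt_trans _ fx)// mulrC.
by rewrite ler_wpM2l ?weighted_ge0// lerDl.
Qed.

Definition C0_space a : lin_subspace V :=
  LinSubspace (C0_closed0 a) (@C0_closedP a).

Lemma Cc_closed0 : Cc_set 0.
Proof.
split; first exact: cst_continuous.
have -> : [set x : X | (0 : V) x != 0] = set0.
  by apply/seteqP; split => x //=; rewrite eqxx.
by rewrite closure0; exact: compact0.
Qed.

Lemma Cc_closedP (k : K) f g : Cc_set f -> Cc_set g -> Cc_set (k *: f + g).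
Proof.
move=> [fc fK] [gc gK]; split; first exact: continuous_lin.
apply: subclosed_compact (compactU fK gK) _; first exact: closed_closure.
rewrite -closureU; apply: closureS => x /= kfg; apply/orP.
apply: contraNT kfg; rewrite negb_or !negbK => /andP[/eqP f0 /eqP g0].
change (k * f x + g x == 0).
by rewrite f0 g0 mulr0 addr0.
Qed.

Definition Cc_space : lin_subspace V := LinSubspace Cc_closed0 Cc_closedP.

End WeightedSpaces.

Arguments C0_set {R X} s a.
Arguments Cc_set {R X} s.

Section NormedSubspace.
Context {R : realType} {X : topologicalType} {s : scalars}.
Local Notation K := (scalar_field R s).
Local Notation V := (X -> K^o).
Variables (a : weight R X) (U : lin_subspace V).
Hypothesis UC0 : lin_carrier U `<=` C0_set s a.

(* The inclusion is an argument of the type because the instances below need it: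
   it makes the supremum in weighted_norm finite. *)
Definition weighted_space of lin_carrier U `<=` C0_set s a : Type := lin_sort U.
Local Notation E := (weighted_space UC0).

HB.instance Definition _ := GRing.Lmodule.copy E (lin_sort U).

Definition weighted_space_norm (f : E) : K :=
  of_real s (weighted_norm a (val (f : lin_sort U))).

Let boundedE (f : E) : has_ubound (range (weighted a (val (f : lin_sort U)))).
Proof. by apply: C0_bounded; apply: UC0; exact: lin_valP. Qed.

Lemma weighted_le_norm (f : E) x :
  weighted a (val (f : lin_sort U)) x <= weighted_norm a (val (f : lin_sort U)).
Proof. by apply: (ub_le_sup (boundedE f)); exists x. Qed.

Lemma weighted_norm_le (f : E) (M : R) : 0 <= M ->
  (forall x, weighted a (val (f : lin_sort U)) x <= M) ->
  weighted_norm a (val (f : lin_sort U)) <= M.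
Proof.
move=> M0 fM; have [[x _]|X0] := pselect (exists x : X, True).
  by apply: ge_sup; [exists (weighted a (val (f : lin_sort U)) x), x|move=> _ [y _ <-]].
rewrite /weighted_norm (_ : range _ = set0) ?sup0//.
by apply/seteqP; split=> // y [x]; case: X0; exists x.
Qed.

Lemma weighted_norm_ge0 (f : E) : 0 <= weighted_norm a (val (f : lin_sort U)).
Proof.
have [[x _]|X0] := pselect (exists x : X, True).
  by rewrite (le_trans _ (weighted_le_norm f x)) ?weighted_ge0.
rewrite /weighted_norm (_ : range _ = set0) ?sup0//.
by apply/seteqP; split=> // y [x]; case: X0; exists x.
Qed.

Let normD (f g : E) :
  weighted_space_norm (f + g) <= weighted_space_norm f + weighted_space_norm g.
Proof.
rewrite /weighted_space_norm -of_realD of_real_le; apply: weighted_norm_le.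
  by apply: addr_ge0; exact: weighted_norm_ge0.
move=> x; apply: (le_trans (weightedD _ _ _ _)).
by apply: lerD; exact: weighted_le_norm.
Qed.

Let normZ_le (k : K) (f : E) : weighted_norm a (val (k *: f : lin_sort U)) <=
  modulus k * weighted_norm a (val (f : lin_sort U)).
Proof.
apply: weighted_norm_le; first by apply: mulr_ge0; [exact: modulus_ge0|exact: weighted_norm_ge0].
move=> x; rewrite [leLHS]weightedZ ler_wpM2l ?modulus_ge0//.
exact: weighted_le_norm.
Qed.

Let normZ (k : K) (f : E) :
  weighted_space_norm (k *: f) = `|k| * weighted_space_norm f.
Proof.
rewrite /weighted_space_norm -of_real_modulus -of_realM; congr of_real.
apply/eqP; rewrite eq_le; apply/andP; split; first exact: normZ_le.
have [->|k0] := eqVneq k 0; first by rewrite modulus0 mul0r; exact: weighted_norm_ge0.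
have kV : modulus k * modulus k^-1 = 1.
  by rewrite -modulusM divff//; apply: (@of_real_inj R s); rewrite of_real_modulus normr1; case: s.
have := normZ_le k^-1 (k *: f); rewrite scalerA mulVf// scale1r => h.
by rewrite (le_trans (ler_wpM2l (modulus_ge0 k) h))// mulrA kV mul1r.
Qed.

Let norm0_eq0 (f : E) : weighted_space_norm f = 0 -> f = 0.
Proof.
rewrite /weighted_space_norm -of_real0 => /of_real_inj f0.
apply: val_inj; apply/funext => x; apply: (@modulus0_eq0 R s).
have := weighted_le_norm f x; rewrite f0 /weighted => h.
apply/eqP; rewrite eq_le modulus_ge0 andbT.
by move: h; rewrite pmulr_rle0// weight_gt0.
Qed.

HB.instance Definition _ := Lmodule_isNormed.Build K E normD normZ norm0_eq0.

Definition weighted_lcs : lcs V :=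
  @LCS K V U (LcTopology (topology_of_locally_convex E)).

End NormedSubspace.

(* The weight a_{N,n} of the double sequence is (a N n). *)
Record weight_system (R : realType) (X : topologicalType) := WeightSystem {
  sys_weight :> nat -> nat -> weight R X ;
  sys_decr : forall N n x, sys_weight N n.+1 x <= sys_weight N n x ;
  sys_incr : forall N n x, sys_weight N n x <= sys_weight N.+1 n x }.

Definition condition_wQ (R : realType) (X : topologicalType)
    (a : weight_system R X) : Prop :=
  forall N, exists M n, forall K m, exists k, exists2 S : R, 0 < S &
    forall x, (a M m x)^-1 <= Num.max (S / a N n x) (S / a K k x).

Section PLBSpaces.
Context {R : realType} {X : topologicalType} (s : scalars).
Local Notation V := (X -> (scalar_field R s)^o).

Definition C0_lcs (a : weight R X) : lcs V :=
  weighted_lcs (@subset_refl _ (lin_carrier (C0_space s a))).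

Definition Cc_lcs (a : weight R X) : lcs V :=
  weighted_lcs (@Cc_subC0 R X s a : lin_carrier (Cc_space s) `<=` C0_set s a).

Lemma C0_lcs_incr (a b : weight R X) : (forall x, b x <= a x) ->
  lcs_set (C0_lcs a) `<=` lcs_set (C0_lcs b).
Proof.
move=> ba f [fc fv]; split=> // e /fv [C cC Cf]; exists C => // x /Cf.
rewrite !ger0_norm ?weighted_ge0//; apply: le_lt_trans.
by rewrite ler_wpM2r ?modulus_ge0.
Qed.

Variable A : weight_system R X.

Definition AC0 : lcs V := proj_lim (fun N =>
  ind_lim (fun n => C0_lcs_incr (sys_decr A N n))).

Definition ACc : lcs V := proj_lim (fun N =>
  @ind_lim _ V (fun n => Cc_lcs (A N n)) (fun n => @subset_refl _ (Cc_set s))).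

End PLBSpaces.

(* Main.v *)
Require Import Defs.
From mathcomp Require Import all_boot all_order all_algebra complex.
From mathcomp Require Import all_classical all_reals all_analysis.
From mathcomp Require Import ring lra.

(** Write w_{N,n} for the reciprocal of a_{N,n}, so that the unit ball of C(a_{N,n})_0
    consists of the functions f with |f| <= w_{N,n}.  Call disc an absolutely convex set
    that contains 0.  A disc of (AC)_0 or (AC)_c is a neighbourhood of 0 if and only if it
    contains the trace of a disc that absorbs the balls of a single step N, for all n
    (plb_nbhs0P).

    Sufficiency of (wQ).  Let W be a disc that absorbs every sequence of C_c that is
    bounded in all steps.  Then W absorbs the functions of C_c below u_L for some L,
    whenever (u_L) is a sequence of functions which for each N is eventually below a
    multiple of some w_{N,n} (exists_absorbs_below).  If every step M had a ball that W does
    not absorb, (wQ) would produce such a sequence contradicting this, made of minima of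
    functions w_{M,m} (wQ_absorbs_below).  The splitting of a function below max(u, v) into
    functions below u and below v makes the induction work (absorbs_below_max).

    Every bornivorous disc of (AC)_c absorbs these sequences by definition.  Every barrel of
    (AC)_0 does so too, by a gliding hump argument (barrel_absorbs_sequence); it is then
    a neighbourhood of 0 because truncations of a function of (AC)_0 converge to it
    (wQ_barrelled).

    Necessity of (wQ).  If (wQ) fails, there are points x_{jk} and bounds phi_{jk} such that
    the set U of the f with |f(x_{jk})| <= phi_{jk} for all j and k absorbs the sets
    bounded in all steps, but not all the balls of any step (not_wQ_points).  Since bounded
    subsets of (AC)_c are bounded in all steps (bounded_plb), U is bornivorous there, and it is
    a barrel of (AC)_0; but it is not a neighbourhood of 0 (not_wQ_not_nbhs). *)

Set Implicit Arguments.
Unset Strict Implicit.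
Unset Printing Implicit Defensive.

Import Order.TTheory GRing.Theory Num.Theory.
Import numFieldNormedType.Exports.

Local Open Scope classical_set_scope.
Local Open Scope ring_scope.

(** * Discs and scalars *)

Section Disc.
Context {K : numDomainType} {E : lmodType K}.

Definition disc (W : set E) :=
  W 0 /\ forall (a b : K) x y, `|a| + `|b| <= 1 -> W x -> W y -> W (a *: x + b *: y).

Lemma discZ (W : set E) (a : K) x : disc W -> `|a| <= 1 -> W x -> W (a *: x).
Proof.
move=> [W0 dW] a1 Wx; have := dW a 0 x 0; rewrite normr0 addr0 scaler0 addr0.
exact.
Qed.

End Disc.

Lemma norm_half_add (K : numFieldType) : `|2^-1 : K| + `|2^-1 : K| <= 1.
Proof.
by rewrite ger0_norm ?invr_ge0// -[_ + _]mulr2n -[X in X <= _]mulr_natr mulVf// pnatr_eq0.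
Qed.

Lemma disc_half {K : numFieldType} {E : lmodType K} (W : set E) x y :
  disc W -> W (2 *: x) -> W (2 *: y) -> W (x + y).
Proof.
move=> [_ dW] Wx Wy.
have -> : x + y = 2^-1 *: (2 *: x) + 2^-1 *: (2 *: y).
  by rewrite !scalerA mulVf ?scale1r// pnatr_eq0.
exact: dW (norm_half_add K) Wx Wy.
Qed.

Section RealScalars.
Context {R : realType} {s : scalars}.
Local Notation K := (scalar_field R s).

Lemma of_real1 : of_real s (1 : R) = 1.
Proof. by case: s. Qed.

Lemma of_realB : {morph of_real s : x y / x - y :> R >-> x - y}.
Proof. by case: s => //= x y; rewrite rmorphB. Qed.

Lemma of_realV (x : R) : of_real s x^-1 = (of_real s x)^-1.
Proof. by case: s => //=; rewrite fmorphV. Qed.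

Lemma norm_of_real (x : R) : `|of_real s x| = of_real s `|x|.
Proof. by case: s => //=; rewrite normc_def /= expr0n addr0 sqrtr_sqr. Qed.

Lemma modulus_of_real (x : R) : modulus (of_real s x) = `|x|.
Proof. by apply: (@of_real_inj R s); rewrite of_real_modulus norm_of_real. Qed.

Lemma modulusN (z : K) : modulus (- z) = modulus z.
Proof. by apply: (@of_real_inj R s); rewrite !of_real_modulus normrN. Qed.

Lemma modulusBC (z w : K) : modulus (z - w) = modulus (w - z).
Proof. by rewrite -modulusN opprB. Qed.

Lemma modulus_norm_lt (z : K) (e : R) : (modulus z < e) = (`|z| < of_real s e).
Proof. by rewrite -of_real_modulus of_real_lt. Qed.

Lemma of_real_gt0 (x : R) : (0 < of_real s x) = (0 < x).
Proof. by rewrite -[0](@of_real0 R s) of_real_lt. Qed.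

Lemma gt0_of_real (z : K) : 0 < z -> exists2 x : R, 0 < x & z = of_real s x.
Proof.
move=> z0; exists (modulus z); last by rewrite of_real_modulus gtr0_norm.
by rewrite -of_real_gt0 of_real_modulus normr_gt0 gt_eqF.
Qed.

Lemma cvg_modulusP {T : Type} (F : set_system T) {FF : Filter F} (f : T -> K) (z : K) :
  (f @ F --> z) <-> forall e : R, 0 < e -> \forall t \near F, modulus (z - f t) < e.
Proof.
split => [/cvgrPdist_lt fz e e0|fz].
  by have := fz _ (etrans (of_real_gt0 e) e0); apply: filterS => t; rewrite modulus_norm_lt.
apply/cvgrPdist_lt => _/gt0_of_real[e e0 ->].
by have := fz _ e0; apply: filterS => t; rewrite modulus_norm_lt.
Qed.

Lemma of_real_continuous : continuous (of_real s : R -> K).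
Proof.
move=> x; apply/cvg_modulusP => e e0; near=> y.
rewrite -of_realB modulus_of_real.
by near: y; apply: cvgr_dist_lt => //; exact: cvg_id.
Unshelve. all: by end_near. Qed.

(** In the complex case the limit is assembled from those of the real and imaginary
    parts, whose moduli are below that of the sequence. *)
Lemma modulus_complete (z : nat -> K) (e : nat -> R) : e @ \oo --> (0 : R) ->
  (forall i j, (i <= j)%N -> modulus (z i - z j) <= e i) ->
  exists l : K, forall i, modulus (z i - l) <= e i.
Proof.
move=> e0 ze.
have real_lim (u : nat -> R) : (forall i j, (i <= j)%N -> `|u i - u j| <= e i) ->
    exists l : R, u @ \oo --> l.
  move=> ue; apply/cvg_ex/cauchy_cvgP/cauchy_exP => d d0.
  have /cvgrPdist_lt/(_ d d0)[i _ ei] := e0.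
  exists (u i); exists i => // j /= ij; rewrite -ball_normE /=.
  apply: le_lt_trans (ue i j ij) _; apply: le_lt_trans (ler_norm _) _.
  by rewrite -normrN -[- _]add0r ei /=.
suff [l zl] : exists l : K, forall d : R, 0 < d -> \forall j \near \oo, modulus (z j - l) < d.
  exists l => i; apply/ler_addgt0Pr => d d0.
  near \oo => j.
  rewrite -(subrK (z j) (z i)) -addrA (le_trans (modulusD _ _))// lerD//.
    by apply: ze; near: j; exact: nbhs_infty_ge.
  by apply: ltW; near: j; exact: zl.
case: s z ze => /= z ze.
  have [l ul] := real_lim z ze; exists l => d d0.
  by near=> j; rewrite distrC; near: j; move: d d0; exact/cvgrPdist_lt.
have normc_re (w : R[i]) : `|complex.Re w| <= Normc.normc w.
  by case: w => a b /=; rewrite -sqrtr_sqr ler_wsqrtr// lerDl sqr_ge0.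
have normc_im (w : R[i]) : `|complex.Im w| <= Normc.normc w.
  by case: w => a b /=; rewrite -sqrtr_sqr ler_wsqrtr// lerDr sqr_ge0.
have normc_le (w : R[i]) : Normc.normc w <= `|complex.Re w| + `|complex.Im w|.
  case: w => a b /=; rewrite -[leRHS]ger0_norm ?addr_ge0// -sqrtr_sqr.
  rewrite ler_wsqrtr// sqrrD !real_normK ?num_real// -addrA lerD2l lerDr.
  by rewrite mulrn_wge0// mulr_ge0.
have [|a za] := real_lim (fun i => complex.Re (z i)).
  by move=> i j /ze; apply: le_trans; rewrite -raddfB normc_re.
have [|b zb] := real_lim (fun i => complex.Im (z i)).
  by move=> i j /ze; apply: le_trans; rewrite -raddfB normc_im.
exists (a +i* b)%C => d d0; have d2 : 0 < d / 2 by rewrite divr_gt0.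
near=> j.
rewrite (le_lt_trans (normc_le _))// (splitr d) ltrD// raddfB /= distrC.
  by near: j; move: d2; move: (d / 2); exact/cvgrPdist_lt.
by near: j; move: d2; move: (d / 2); exact/cvgrPdist_lt.
Unshelve. all: by end_near. Qed.

Lemma modulusV (z : K) : modulus z^-1 = (modulus z)^-1.
Proof. by apply: (@of_real_inj R s); rewrite of_realV !of_real_modulus normfV. Qed.

End RealScalars.

(** * Functions bounded by multiples of reciprocals of weights *)

Section Functions.
Context {R : realType} {s : scalars} {X : topologicalType}.
Local Notation K := (scalar_field R s).
Local Notation V := (X -> K^o).
Implicit Types (f : V) (u v w : X -> R).

Definition dominated f u := forall x, modulus (f x) <= u x.

Definition rmul u f : V := fun x => of_real s (u x) * f x.

Lemma modulus_rmul u f x : modulus (rmul u f x) = `|u x| * modulus (f x).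
Proof. by rewrite modulusM modulus_of_real. Qed.

Lemma modulusZ (k : K) f x : modulus ((k *: f) x) = modulus k * modulus (f x).
Proof. exact: modulusM. Qed.

Lemma rmul_continuous u f : continuous u -> continuous (f : X -> K) ->
  continuous (rmul u f : X -> K).
Proof.
move=> uc fc x; apply: cvgM; last exact: fc.
by apply: continuous_cvg; [exact: of_real_continuous|exact: uc].
Qed.

Lemma Cc_rmul u f : continuous u -> Cc_set s f -> Cc_set s (rmul u f).
Proof.
move=> uc [fc fK]; split; first exact: rmul_continuous.
apply: subclosed_compact fK _; first exact: closed_closure.
apply: closureS => x /=; apply: contraNN => /eqP fx0.
by rewrite /rmul fx0 mulr0.
Qed.

Lemma CcZ (k : K) f : Cc_set s f -> Cc_set s (k *: f).
Proof.
by move=> Cf; rewrite -[_ *: _]addr0; apply: Cc_closedP => //; exact: Cc_closed0.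
Qed.

Lemma CcD f g : Cc_set s f -> Cc_set s g -> Cc_set s (f + g).
Proof. by move=> Cf Cg; rewrite -[f]scale1r; apply: Cc_closedP. Qed.

Lemma dominated_weight (a : weight R X) f (c : R) :
  dominated f (fun x => c / a x) <-> forall x, weighted a f x <= c.
Proof. by split=> fc x; have := fc x; rewrite /weighted ler_pdivlMr ?weight_gt0// mulrC. Qed.

Lemma C0_dominated (a : weight R X) f : C0_set s a f ->
  exists2 c : R, 0 < c & dominated f (fun x => c / a x).
Proof.
move=> /C0_bounded[c fc]; exists (Num.max c 1); first by rewrite lt_max ltr01 orbT.
by apply/dominated_weight => x; rewrite le_max fc//; exists x.
Qed.

End Functions.

(** * Condition (wQ) and absorption of balls *)

Section Core.
Context {R : realType} {s : scalars} {X : topologicalType}.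
Local Notation K := (scalar_field R s).
Local Notation V := (X -> K^o).
Variables (A : weight_system R X) (W : set V).
Hypothesis dW : disc W.
Implicit Types (f : V) (u v w : X -> R).

Local Notation w_ N n := (fun x => (A N n x)^-1).

Lemma w_gt0 N n x : 0 < w_ N n x.
Proof. by rewrite invr_gt0 weight_gt0. Qed.

Lemma w_continuous N n : continuous (w_ N n).
Proof.
by move=> x; apply: cvgV; [rewrite gt_eqF ?weight_gt0|exact: weight_continuous].
Qed.

Lemma w_incr N m n x : (m <= n)%N -> w_ N m x <= w_ N n x.
Proof.
move=> /subnK <-; elim: (n - m)%N => [//|k] /le_trans; apply.
by rewrite lef_pV2 ?posrE ?weight_gt0// sys_decr.
Qed.

Lemma w_decr M N n x : (M <= N)%N -> w_ N n x <= w_ M n x.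
Proof.
move=> /subnK <-; elim: (N - M)%N => [//|k]; apply: le_trans.
by rewrite lef_pV2 ?posrE ?weight_gt0// sys_incr.
Qed.

(** When u is the reciprocal of a weight a, this says that W absorbs the unit ball of
    C(a)_c; the proofs below also need it for minima of such functions. *)
Definition absorbs_below u :=
  exists2 e : R, 0 < e & forall f, Cc_set s f -> dominated f (fun x => e * u x) -> W f.

Definition eventually_bounded (f : nat -> V) :=
  forall N, exists n, exists2 c : R, 0 < c &
    \forall L \near \oo, dominated (f L) (fun x => c * w_ N n x).

Hypothesis W_seq : forall f : nat -> V, (forall L, Cc_set s (f L)) ->
  eventually_bounded f ->
  exists2 e : R, 0 < e & forall L, W (of_real s e *: f L).

Lemma absorbs_belowS u v : (forall x, u x <= v x) -> absorbs_below v -> absorbs_below u.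
Proof.
move=> uv [e e0 We]; exists e => // f Cf fu; apply: We => // x.
by rewrite (le_trans (fu x))// ler_wpM2l// ltW.
Qed.

(** A function below max(u, v) is the sum of its products with u / (u + v) and
    v / (u + v), which lie below u and below v respectively. *)
Lemma absorbs_below_max u v w (S : R) : continuous u -> continuous v ->
    (forall x, 0 < u x) -> (forall x, 0 < v x) -> (forall x, 0 < w x) ->
    (forall x, w x <= S * Num.max (u x) (v x)) ->
  absorbs_below (fun x => Num.min (u x) (w x)) ->
  absorbs_below (fun x => Num.min (v x) (w x)) -> absorbs_below w.
Proof.
move=> uc vc u0 v0 w0 wS [e1 e10 W1] [e2 e20 W2].
pose T := Num.max S 1; have T0 : 0 < T by rewrite lt_max ltr01 orbT.
have T1 : 1 <= T by rewrite le_max lexx orbT.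
pose e := Num.min e1 e2 / (2 * T).
have e0 : 0 < e by rewrite divr_gt0 ?lt_min ?e10// mulr_gt0.
exists e => // f Cf fw.
have uv0 x : 0 < u x + v x by rewrite addr_gt0.
(* 2 g is estimated rather than g because a disc contains x + y as soon as it contains
   2 x and 2 y *)
have part (p : X -> R) : continuous p -> (forall x, 0 < p x) -> (forall x : X, p x <= u x + v x) ->
    let g : V := rmul (fun x => p x / (u x + v x)) f in
    Cc_set s (2 *: g) /\
    dominated (2 *: g) (fun x => Num.min e1 e2 * Num.min (p x) (w x)).
  move=> pc p0 puv g; split.
    apply: CcZ; apply: Cc_rmul => //.
    move=> x; apply: cvgM; first exact: pc.
    by apply: cvgV; [rewrite gt_eqF|apply: cvgD; [exact: uc|exact: vc]].
  move=> x; rewrite [leLHS]modulusM modulus_rmul.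
  have -> : modulus (2 : K) = 2.
    by rewrite -[2]/(1 + 1) -of_real1 -of_realD modulus_of_real ger0_norm.
  have m0 : 0 < Num.min e1 e2 by rewrite lt_min e10.
  have q0 : 0 <= p x / (u x + v x) by apply: divr_ge0; exact: ltW.
  rewrite ger0_norm// minr_pMr ?(ltW m0)//.
  have q1 : p x / (u x + v x) <= 1 by rewrite ler_pdivrMr ?mul1r.
  have fe : 2 * modulus (f x) <= Num.min e1 e2 / T * w x.
    rewrite (le_trans (ler_wpM2l _ (fw x)))// mulrA ler_wpM2r ?(ltW (w0 x))//.
    by rewrite /e mulrCA invfM mulVKf ?pnatr_eq0.
  have eT : Num.min e1 e2 / T <= Num.min e1 e2.
    by rewrite ler_pdivrMr// ler_peMr// ltW.
  have wT : w x / T <= u x + v x.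
    rewrite ler_pdivrMr// mulrC (le_trans (wS x))//.
    have uv : Num.max (u x) (v x) <= u x + v x.
      by rewrite ge_max lerDl lerDr (ltW (u0 x)) (ltW (v0 x)).
    apply: (@le_trans _ _ (T * Num.max (u x) (v x))).
      by rewrite ler_wpM2r// ?le_max ?lexx// (ltW (u0 x)).
    by rewrite ler_wpM2l// ltW.
  rewrite mulrCA le_min; apply/andP; split.
    rewrite (le_trans (ler_wpM2l q0 fe))// -mulrA [_ * w x]mulrC.
    rewrite mulrCA ler_wpM2l ?(ltW m0)// (le_trans (ler_wpM2l q0 wT))//.
    by rewrite divfK// gt_eqF.
  rewrite -[leRHS]mul1r ler_pM// ?mulr_ge0 ?modulus_ge0//.
  by rewrite (le_trans fe)// ler_wpM2r// (ltW (w0 x)).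
have [Cg gW] := part u uc u0 (fun x => ltac:(by rewrite lerDl ltW)).
have [Ch hW] := part v vc v0 (fun x => ltac:(by rewrite lerDr ltW)).
have -> : f = rmul (fun x => u x / (u x + v x)) f + rmul (fun x => v x / (u x + v x)) f.
  apply/funext => x; rewrite /rmul.
  change (f x = of_real s (u x / (u x + v x)) * f x + of_real s (v x / (u x + v x)) * f x).
  by rewrite -mulrDl -of_realD -mulrDl divff ?gt_eqF// of_real1 mul1r.
apply: disc_half => //.
- apply: W1 => // x; rewrite (le_trans (gW x))// ler_wpM2r ?ge_min ?lexx//.
  by rewrite le_min !ltW.
- apply: W2 => // x; rewrite (le_trans (hW x))// ler_wpM2r ?ge_min ?lexx ?orbT//.
  by rewrite le_min !ltW.
Qed.

(** Otherwise there would be functions f_L outside W and below u_L / (L+1); the sequence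
    of the (L+1) f_L is absorbed by W, hence W contains f_L for large L. *)
Lemma exists_absorbs_below (u : nat -> X -> R) :
  (forall N, exists n, exists2 c : R, 0 < c &
    \forall L \near \oo, forall x, u L x <= c * w_ N n x) ->
  exists L, absorbs_below (u L).
Proof.
move=> uA; apply/not_existsP => nW.
have [f /all_and3[Cf fu nWf]] : {f : nat -> V & forall L, [/\ Cc_set s (f L),
    dominated (f L) (fun x => L.+1%:R^-1 * u L x) & ~ W (f L)]}.
  apply: (@choice _ _ (fun L f => [/\ Cc_set s f,
    dominated f (fun x => L.+1%:R^-1 * u L x) & ~ W f])) => L.
  apply/not_existsP => nf; apply: (nW L); exists L.+1%:R^-1; first by rewrite invr_gt0.
  by move=> f Cf fu; apply: contrapT => nWf; apply: (nf f).
have [| |e e0 We] := @W_seq (fun L => of_real s L.+1%:R *: f L).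
- by move=> L; exact: CcZ.
- move=> N; have [n [c c0 uc]] := uA N; exists n, c => //.
  apply: filterS uc => L uc x; rewrite [leLHS]modulusM modulus_of_real ger0_norm//.
  rewrite (le_trans _ (uc x))// mulrC -ler_pdivlMr// mulrC.
  exact: fu.
have [L Le] : exists L : nat, e^-1 <= L.+1%:R.
  have := archi_boundP (ltW (_ : 0 < e^-1)); rewrite invr_gt0 => /(_ e0) eL.
  exists (Num.bound e^-1); rewrite (le_trans (ltW eL))// ler_nat//.
apply: (nWf L); have := We L; rewrite scalerA -of_realM.
set k := e * _; have k1 : 1 <= k by rewrite /k -ler_pdivrMl// mulr1.
move=> /(discZ (a := of_real s k^-1) dW); rewrite scalerA -of_realM.
rewrite mulVf ?of_real1 ?scale1r; last first.
  by rewrite gt_eqF// (lt_le_trans _ k1).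
apply; rewrite norm_of_real -of_real1 of_real_le ger0_norm ?invf_le1//.
  by rewrite (lt_le_trans _ k1).
by rewrite invr_ge0 (le_trans _ k1).
Qed.

(** Condition (wQ) yields for every N an M such that some w_{N,n} splits M.  The notion
    is stated for general u because it is preserved by minima. *)
Definition splits u M := [/\ continuous u, (forall x, 0 < u x) &
  forall N m, exists n, exists2 c : R, 0 < c &
    forall x, w_ M m x <= c * Num.max (u x) (w_ N n x)].

(** For each N the weight w_{M,m} is at most a multiple of max(u, w_{N,n_N}).  Hence it is
    also at most a multiple of max(u, v_L), where v_L is the minimum over N <= L of
    multiples of the w_{N,n_N}; and W absorbs the functions below v_L for some L. *)
Lemma absorbs_below_splits u M : splits u M ->
  (forall m, absorbs_below (fun x => Num.min (u x) (w_ M m x))) ->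
  forall m, absorbs_below (w_ M m).
Proof.
move=> [uc u0 us] uW m.
have [n nP] := choice (fun N => us N m).
have [c /all_and2[c0 cP]] : {c : nat -> R & forall N, 0 < c N /\
    forall x, w_ M m x <= c N * Num.max (u x) (w_ N (n N) x)}.
  apply: (@choice _ _ (fun N c => 0 < c /\
    forall x, w_ M m x <= c * Num.max (u x) (w_ N (n N) x))) => N.
  by have [c] := nP N; exists c.
pose v := fix v L : X -> R := if L is L'.+1 then
  fun x => Num.min (v L' x) (c L * w_ L (n L) x) else fun x => c 0%N * w_ 0 (n 0%N) x.
have cw0 N x : 0 < c N * w_ N (n N) x by rewrite mulr_gt0 ?w_gt0.
have cwc N : continuous (fun x => c N * w_ N (n N) x).
  by move=> x; apply: cvgM; [exact: cvg_cst|exact: w_continuous].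
have v0 L x : 0 < v L x.
  by elim: L => [|L IH] /=; [exact: cw0|rewrite lt_min IH cw0].
have vc L : continuous (v L).
  elim: L => [|L IH] /=; first exact: cwc.
  by move=> x; apply: continuous_min; [exact: IH|exact: cwc].
have v_le L N x : (N <= L)%N -> v L x <= c N * w_ N (n N) x.
  elim: L => [|L IH]; first by rewrite leqn0 => /eqP->.
  rewrite leq_eqVlt => /predU1P[->|/IH vN] /=; first by rewrite ge_min lexx orbT.
  by rewrite ge_min vN.
have wv L : exists2 T : R, 1 <= T & forall x, w_ M m x <= T * Num.max (u x) (v L x).
  have step N x : w_ M m x <= Num.max (c N) 1 * Num.max (u x) (c N * w_ N (n N) x).
    have cN : c N <= Num.max (c N) 1 by rewrite le_max lexx.
    have cN1 : 1 <= Num.max (c N) 1 by rewrite le_max lexx orbT.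
    have := cP N x; rewrite [X in _ <= _ * X]maxEle; case: ifP => _ le.
      apply: (@le_trans _ _ (Num.max (u x) (c N * w_ N (n N) x))).
        by rewrite le_max le orbT.
      by rewrite ler_peMl// le_max (ltW (u0 x)).
    rewrite (le_trans le)// ler_pM// ?(ltW (c0 N)) ?(ltW (u0 x))//.
    by rewrite le_max lexx.
  elim: L => [|L [T T1 IH]].
    by exists (Num.max (c 0%N) 1); [rewrite le_max lexx orbT|exact: step].
  exists (Num.max T (Num.max (c L.+1) 1)); first by rewrite le_max T1.
  move=> x /=; set S := Num.max (c L.+1) 1; set y := c L.+1 * _.
  have := IH x; have := step L.+1 x; rewrite -/S -/y.
  have S0 : 0 < S by rewrite lt_max ltr01 orbT.
  have T0 : 0 < T by rewrite (lt_le_trans _ T1).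
  have TS : T <= Num.max T S by rewrite le_max lexx.
  have ST : S <= Num.max T S by rewrite le_max lexx orbT.
  rewrite max_minr minr_pMr ?(le_trans _ TS) ?(ltW T0)// => le1 le2.
  rewrite le_min; apply/andP; split.
    by rewrite (le_trans le2)// ler_wpM2r// le_max (ltW (u0 x)).
  by rewrite (le_trans le1)// ler_wpM2r// le_max (ltW (u0 x)).
have [|L LW] := @exists_absorbs_below (fun L x => Num.min (v L x) (w_ M m x)).
  move=> N; exists (n N), (c N) => //; exists N => // L /= NL x.
  by rewrite ge_min v_le.
have [T _ wT] := wv L.
by apply: (@absorbs_below_max u (v L) (w_ M m) T) => // x; exact: w_gt0.
Qed.

(** If each step M had a ball that W does not absorb, then absorbs_below_splits would
    allow to choose successively indices (M_i, m_i), with M_i increasing, such that W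
    absorbs, for i >= 1, none of the minima of w_{M_0,m_0}, ..., w_{M_i,m_i}.  This contradicts
    exists_absorbs_below. *)
Lemma wQ_absorbs_below : condition_wQ A -> exists M, forall m, absorbs_below (w_ M m).
Proof.
move=> wQ; apply/not_existsP => nW.
have {}nW M : exists m, ~ absorbs_below (w_ M m) by exact/existsNP.
have {}wQ N : exists M n, forall K m, exists k, exists2 c : R, 0 < c &
    forall x, w_ M m x <= c * Num.max (w_ N n x) (w_ K k x).
  have [M [n wQn]] := wQ N; exists M, n => K m; have [k [c c0 wc]] := wQn K m.
  exists k, c => // x; rewrite (le_trans (wc x))// maxr_pMr ?lexx// ltW//.
have splits_w N : exists n M, forall n', (n <= n')%N -> splits (w_ N n') M.
  have [M [n wQn]] := wQ N; exists n, M => n' nn'.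
  split; [exact: w_continuous|by move=> x; exact: w_gt0|move=> K m].
  have [k [c c0 wc]] := wQn K m; exists k, c => // x.
  rewrite (le_trans (wc x))// ler_wpM2l ?(ltW c0)//.
  by rewrite ge_max !le_max lexx orbT w_incr.
have splitsS u M M' : (M <= M')%N -> splits u M -> splits u M'.
  move=> MM' [uc u0 us]; split=> // N m; have [n [c c0 wc]] := us N m.
  by exists n, c => // x; rewrite (le_trans _ (wc x))// w_decr.
have splitsI u v M : splits u M -> splits v M -> splits (fun x => Num.min (u x) (v x)) M.
  move=> [uc u0 us] [vc v0 vs]; split.
  - by move=> x; apply: continuous_min; [exact: uc|exact: vc].
  - by move=> x; rewrite lt_min u0 v0.
  move=> N m; have [n [c c0 wc]] := us N m; have [n' [c' c0' wc']] := vs N m.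
  exists (maxn n n'), (Num.max c c'); first by rewrite lt_max c0.
  move=> x; rewrite max_minl minr_pMr ?le_max ?(ltW c0)//.
  rewrite le_min; apply/andP; split.
    rewrite (le_trans (wc x))//; apply: ler_pM; first exact: ltW.
    + by rewrite le_max (ltW (u0 x)).
    + by rewrite le_max lexx.
    + by rewrite ge_max !le_max lexx w_incr ?leq_maxl ?orbT.
  rewrite (le_trans (wc' x))//; apply: ler_pM; first exact: ltW.
  + by rewrite le_max (ltW (v0 x)).
  + by rewrite le_max lexx orbT.
  + by rewrite ge_max !le_max lexx w_incr ?leq_maxr ?orbT.
pose state := {p : (X -> R) * nat | splits p.1 p.2}.
pose next (p q : state) := [/\ forall x, (sval q).1 x <= (sval p).1 x,
  exists m, forall x, (sval q).1 x <= w_ (sval p).2 m x,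
  ((sval p).2 < (sval q).2)%N & ~ absorbs_below (sval q).1].
have nextP p : {q | next p q}.
  apply: cid; case: p => -[u M] /= up.
  have [m mW] : exists m, ~ absorbs_below (fun x => Num.min (u x) (w_ M m x)).
    apply/existsNP => uW; have [m] := nW M; apply.
    exact: (absorbs_below_splits up uW).
  have [n [M' sM']] := splits_w M.
  pose m' := maxn m n; pose M'' := maxn M' M.+1.
  have s'' : splits (fun x => Num.min (u x) (w_ M m' x)) M''.
    apply: splitsI; first by apply: (splitsS _ M) => //; rewrite /M'' leq_max leqnSn orbT.
    by apply: (splitsS _ M'); [exact: leq_maxl|apply: sM'; exact: leq_maxr].
  exists (exist _ (_, _) s''); split=> /=.
  - by move=> x; rewrite ge_min lexx.
  - by exists m' => x; rewrite ge_min lexx orbT.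
  - by rewrite /M'' leq_max leqnn orbT.
  - apply: contra_not mW; apply: absorbs_belowS => x.
    by rewrite le_min !ge_min lexx/= w_incr ?leq_maxl ?orbT.
have [n0 [M0 s0]] := splits_w 0%N.
have p0 : state by exists (w_ 0 n0, M0); exact: s0.
have [p [_ /all_and4[p_decr p_le p_lt p_W]]] := dependent_choice nextP p0.
have pM L : (L <= (sval (p L)).2)%N.
  by elim: L => [//|L IH]; exact: leq_ltn_trans IH (p_lt L).
have p_mono L L' x : (L <= L')%N -> (sval (p L')).1 x <= (sval (p L)).1 x.
  by move=> /subnK <-; elim: (L' - L)%N => [//|k]; apply: le_trans; exact: p_decr.
have [|L] := @exists_absorbs_below (fun L => (sval (p L.+1)).1); last exact: p_W.
move=> N; have [m pm] := p_le N; exists m, 1 => //; exists N => // L /= NL x.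
rewrite mul1r (le_trans (p_mono N.+1 _ _ _))// (le_trans (pm x))//.
exact: w_decr.
Qed.

End Core.

(** * The locally convex topology generated by an absorbing disc *)

Lemma pos_lower_bound (K : numFieldType) (d e : K) : 0 < d -> 0 < e ->
  exists r : K, [/\ 0 < r, r <= d & r <= e].
Proof.
move=> d0 e0; case: (real_leP (gtr0_real d0) (gtr0_real e0)) => de.
  by exists d.
by exists e; split=> //; exact: ltW.
Qed.

(** The multiples of W are a basis of neighbourhoods of 0.  In the supremum that defines
    the finest locally convex topology, this topology is the member that turns a given
    disc into a neighbourhood of 0. *)
Section GaugeTopology.
Context {K : numFieldType} {E : lmodType K}.
Variable W : set E.
Hypothesis dW : disc W.
Hypothesis W_absorbing : forall x, exists2 r : K, 0 < r & W (r *: x).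

Definition gauge_opens : set_system E :=
  [set O | forall x, O x -> exists2 e : K, 0 < e & forall w, W w -> O (x + e *: w)].

Lemma discM (x : E) (a b : K) w : 0 <= a -> a <= b -> 0 < b -> W w ->
  exists2 w', W w' & x + a *: w = x + b *: w'.
Proof.
move=> a0 ab b0 Ww; exists ((a / b) *: w); last by rewrite scalerA mulrC divfK// gt_eqF.
by apply: discZ => //; rewrite ger0_norm ?divr_ge0 ?(ltW b0)// ler_pdivrMr// mul1r.
Qed.

Lemma gauge_opensT : gauge_opens setT.
Proof. by move=> x _; exists 1. Qed.

Lemma gauge_opensI : setI_closed gauge_opens.
Proof.
move=> O P oO oP x [Ox Px].
have [d d0 dO] := oO x Ox.
have [e e0 eP] := oP x Px.
have [r [r0 rd re]] := pos_lower_bound d0 e0.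
exists r => // w Ww; split.
  by have [w' Ww' ->] := discM x (ltW r0) rd d0 Ww; exact: dO.
by have [w' Ww' ->] := discM x (ltW r0) re e0 Ww; exact: eP.
Qed.

Lemma gauge_opens_bigcup (F : set_system E) :
  F `<=` gauge_opens -> gauge_opens (\bigcup_(O in F) O).
Proof.
move=> Fo x [Q FQ Qx]; have [e e0 eO] := Fo Q FQ x Qx.
by exists e => // w Ww; exists Q => //; exact: eO.
Qed.

Definition gauge_topology : topology_on E :=
  TopologyOn gauge_opensT gauge_opensI gauge_opens_bigcup.

Local Notation T := (topologized gauge_topology).

Definition gauge_interior (A : set E) : set E :=
  [set y | exists2 e : K, 0 < e & forall w, W w -> A (y + e *: w)].

Lemma gauge_interior_open A : gauge_opens (gauge_interior A).
Proof.
move=> y [e e0 eA]; have e2 : 0 < e / 2 by rewrite divr_gt0.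
exists (e / 2) => // w Ww; exists (e / 2) => // w' Ww'.
rewrite -addrA -scalerDr (_ : e / 2 *: (w + w') = e *: (2^-1 *: w + 2^-1 *: w')).
  by apply: eA; apply: dW.2 => //; exact: norm_half_add.
by rewrite -scalerDr scalerA.
Qed.

Lemma gauge_interior_sub A : gauge_interior A `<=` A.
Proof. by move=> y [e _ eA]; have := eA 0 dW.1; rewrite scaler0 addr0. Qed.

Lemma gauge_nbhsP (x : T) (A : set T) : nbhs x A <-> gauge_interior A x.
Proof.
split.
  rewrite nbhsE => -[P [oP Px] PA].
  by have [e e0 eO] := oP x Px; exists e => // w /eO /PA.
move=> Ax; rewrite nbhsE; exists (gauge_interior A); last exact: gauge_interior_sub.
by split=> //; exact: gauge_interior_open.
Qed.

Lemma gauge_locally_convex : is_locally_convex gauge_topology.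
Proof.
have half1 := norm_half_add K.
split.
- move=> [x y] A /gauge_nbhsP[e e0 eA]; have e2 : 0 < e / 2 by rewrite divr_gt0.
  pose N (z : T) : set T := [set z' | exists2 w, W w & z' = z + (e / 2) *: w].
  have zN z : nbhs z (N z) by apply/gauge_nbhsP; exists (e / 2) => // w Ww; exists w.
  exists (N x, N y) => //= -[_ _] /= [[w Ww ->] [w' Ww' ->]].
  rewrite addrACA -scalerDr.
  rewrite (_ : e / 2 *: (w + w') = e *: (2^-1 *: w + 2^-1 *: w')).
    by apply: eA; apply: dW.2.
  by rewrite -scalerDr scalerA.
- move=> [k x] A /gauge_nbhsP[e e0 eA]; have [r r0 rx] := W_absorbing x.
  have e2 : 0 < e / 2 by rewrite divr_gt0.
  pose d := r * (e / 2); have d0 : 0 < d by rewrite mulr_gt0.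
  have kd : 0 < `|k| + d by rewrite ltr_wpDl.
  pose c := e / 2 / (`|k| + d); have c0 : 0 < c by rewrite divr_gt0.
  exists ([set k' : K^o | `|k - k'| < d], [set x' : T | exists2 w, W w & x' = x + c *: w]).
    split=> /=; last by apply/gauge_nbhsP; exists c => // w Ww; exists w.
    by have := nbhsx_ballx (k : K^o) d d0; rewrite -ball_normE.
  move=> [k' _] /= [kk' [w Ww ->]].
  have -> : k' *: (x + c *: w) =
      k *: x + e *: (((k' - k) / (r * e)) *: (r *: x) + (k' * c / e) *: w).
    rewrite scalerDr [in RHS]scalerDr !scalerA addrA -scalerDl; congr (_ *: _ + _ *: _).
      by field; rewrite !gt_eqF.
    by field; rewrite gt_eqF.
  apply: eA; apply: dW.2 => //; rewrite (le_trans _ half1)// lerD//;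
    rewrite [leRHS]ger0_norm ?invr_ge0//.
    rewrite normrM normfV (gtr0_norm (_ : 0 < r * e)) ?mulr_gt0// ler_pdivrMr ?mulr_gt0//.
    rewrite distrC (le_trans (ltW kk'))//.
    by rewrite le_eqVlt; apply/orP; left; apply/eqP; rewrite /d; field.
  have -> : k' * c / e = k' / (`|k| + d) * 2^-1 by rewrite /c; field; rewrite !gt_eqF.
  rewrite normrM [`|2^-1|]ger0_norm ?invr_ge0// ler_piMl ?invr_ge0//.
  rewrite normrM normfV (gtr0_norm kd) ler_pdivrMr// mul1r.
  rewrite -[k'](subrK k) addrC (le_trans (ler_normD _ _))// lerD2l distrC.
  exact: ltW.
- exists [set b : set T | open b /\ convex_set (b : set E)].
    by move=> b; rewrite inE => -[].
  split=> [b []//|x A /gauge_nbhsP[e e0 eA]].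
  exists (gauge_interior [set y | exists2 w, W w & y = x + e *: w]).
    split; last by exists e => // w Ww; exists w.
    split; first exact: gauge_interior_open.
    apply/convex_setW => y z; rewrite !inE => -[a a0 ya] [b b0 zb] l l0 l1.
    have [r [r0 ra rb]] := pos_lower_bound a0 b0.
    rewrite inE; exists r => // w Ww.
    have [w1 Ww1 yw] := discM y (ltW r0) ra a0 Ww.
    have [w2 Ww2 zw] := discM z (ltW r0) rb b0 Ww.
    have [w3 Ww3 yw3] := ya _ Ww1; have [w4 Ww4 zw4] := zb _ Ww2.
    exists (l%:num *: w3 + (1 - l%:num) *: w4).
      apply: dW.2 => //; rewrite !ger0_norm ?subr_ge0 ?(ltW l0) ?(ltW l1)//.
      by rewrite addrC subrK.
    rewrite /conv /=.
    have -> : l%:num *: y + (1 - l%:num) *: z + r *: w =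
        l%:num *: (y + r *: w) + (1 - l%:num) *: (z + r *: w).
      rewrite !scalerDr addrACA; congr (_ + _).
      by rewrite -scalerDl addrC subrK scale1r.
    rewrite yw zw yw3 zw4 !scalerDr addrACA; congr (_ + _).
      by rewrite -scalerDl addrC subrK scale1r.
    by rewrite !scalerA; congr (_ *: _ + _ *: _); rewrite mulrC.
  by move=> y /gauge_interior_sub[w Ww ->]; exact: eA.
Qed.

End GaugeTopology.

(** * Neighbourhoods of zero in inductive and projective limits *)

Lemma absolutely_convex_disc (K : numFieldType) (E : tvsType K) (U : set E) :
  U 0 -> absolutely_convex U -> disc U.
Proof.
move=> U0 [cU bU]; split=> // a b x y ab Ux Uy.
have [a0|a0] := eqVneq a 0.
  rewrite a0 scale0r add0r; apply: bU => //.
  by rewrite (le_trans _ ab)// lerDr.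
have [b0|b0] := eqVneq b 0.
  rewrite b0 scale0r addr0; apply: bU => //.
  by rewrite (le_trans _ ab)// lerDl.
have p0 : 0 < `|a| by rewrite normr_gt0.
have q0 : 0 < `|b| by rewrite normr_gt0.
have pq0 : 0 < `|a| + `|b| by rewrite addr_gt0.
pose l := `|a| / (`|a| + `|b|).
have l0 : 0 < l by rewrite divr_gt0.
have l1 : l <= 1 by rewrite ler_pdivrMr// mul1r lerDl.
have lE : 1 - l = `|b| / (`|a| + `|b|) by rewrite /l; field; rewrite gt_eqF.
have part c z : c != 0 -> U z -> U ((c / (`|c| / (`|a| + `|b|))) *: z).
  move=> c0 Uz; apply: bU => //.
  rewrite normrM normfV [ `| _ / _ |]ger0_norm ?divr_ge0 ?(ltW pq0)//.
  by rewrite invfM invrK mulrA divff ?mul1r// normr_eq0.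
have Ux' : (a / l) *: x \in U by apply/mem_set; exact: part.
have Uy' : (b / (1 - l)) *: y \in U by apply/mem_set; rewrite lE; exact: part.
have := cU _ _ (Itv01 (ltW l0) l1) Ux' Uy'.
rewrite inE /conv /= !scalerA [l * _]mulrC [(1 - l) * _]mulrC !divfK ?gt_eqF//.
by rewrite lE divr_gt0.
Qed.

Lemma disc_absolutely_convex (K : numFieldType) (E : tvsType K) (U : set E) :
  disc U -> absolutely_convex U.
Proof.
move=> dU; split; last by move=> k x k1; exact: discZ.
move=> x y l; rewrite !inE => Ux Uy; rewrite /conv /=; apply: dU.2 => //.
by rewrite !ger0_norm ?subr_ge0// addrC subrK.
Qed.

(** The largest balanced subset of a convex neighbourhood of 0 is convex, and it is a
    neighbourhood of 0 because scaling is continuous at (0, 0). *)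
Lemma nbhs0_disc (K : numFieldType) (E : tvsType K) (U : set E) : nbhs 0 U ->
  exists W : set E, [/\ disc W, nbhs 0 W & W `<=` U].
Proof.
have [B cB [Bo Bb]] := @locally_convex K E.
move=> /Bb[b [Bb' b0] bU]; have nb : nbhs 0 b.
  by apply: open_nbhs_nbhs; split=> //; exact: Bo.
exists [set x | forall k : K, `|k| <= 1 -> b (k *: x)]; split.
- apply: absolutely_convex_disc; first by move=> k _; rewrite scaler0.
  split=> [x y l|k x k1 bx k' k1'].
    rewrite !inE => bx by' k k1; have := cB b (mem_set Bb') (k *: x) (k *: y) l.
    rewrite !inE /conv /= => /(_ (bx k k1) (by' k k1)).
    by rewrite scalerDr !scalerA ![k * _]mulrC.
  by rewrite scalerA; apply: bx; rewrite normrM mulr_ile1.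
- have := @scale_continuous K E (0, 0) b; rewrite /= scaler0 => /(_ nb)[[P Q] /= [P0 Q0] PQb].
  have /nbhs_ballP[e /= e0 eP] := P0.
  have e2 : 0 < e / 2 by rewrite divr_gt0.
  apply: filterS (nbhs0Z (lt0r_neq0 e2) Q0) => _ [y Qy <-] k k1.
  rewrite scalerA; apply: (PQb (_, y)); split => //=; apply: eP.
  rewrite -ball_normE /= sub0r normrN normrM (gtr0_norm e2).
  rewrite (le_lt_trans (ler_piMl (ltW e2) k1))// ltr_pdivrMr// ltr_pMr// ltr1n//.
- by move=> x /(_ 1); rewrite normr1 scale1r => /(_ (lexx _)) /bU.
Qed.

Section IndLimit.
Context {K : numFieldType} {V : lmodType K} (E : nat -> lcs V).
Hypothesis E_incr : forall n, lcs_set (E n) `<=` lcs_set (E n.+1).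

Lemma ind_lim_nbhs0_preimage (U : set (lcs_tvs (ind_lim E_incr))) n :
  nbhs 0 U -> nbhs (0 : lcs_tvs (E n)) (@ind_incl K V E E_incr n @^-1` U).
Proof.
move=> U0.
suff : (@ind_incl K V E E_incr n @ (0 : lcs_tvs (E n))) -->
  (0 : topologized (finest_locally_convex (@ind_incl K V E E_incr))) by exact.
have FF : Filter (@ind_incl K V E E_incr n @ (0 : lcs_tvs (E n))).
  exact: (@fmap_filter _ _ _ _ (@nbhs_filter (lcs_tvs (E n)) 0)).
apply/(@cvg_sup_topology_on _ _ _ _ _ FF) => -[t [tlc tc]].
have := tc n (0 : lcs_tvs (E n)).
by rewrite /continuous_at (_ : ind_incl _ _ = 0)//; exact: val_inj.
Qed.

(** The topology generated by U makes the inclusions continuous, so that the finest such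
    topology refines it. *)
Lemma ind_lim_nbhs0 (U : set (lcs_tvs (ind_lim E_incr))) : disc U ->
  (forall n, nbhs (0 : lcs_tvs (E n)) (@ind_incl K V E E_incr n @^-1` U)) -> nbhs 0 U.
Proof.
move=> dU nU; have inclZ n k v : @ind_incl K V E E_incr n (k *: v) = k *: ind_incl E_incr v.
  by apply: val_inj.
have inclD n u v : @ind_incl K V E E_incr n (u + v) = ind_incl E_incr u + ind_incl E_incr v.
  by apply: val_inj.
have U_abs (x : lin_sort (ind_space E_incr)) : exists2 r : K, 0 < r & U (r *: x).
  have [n _ xn] := lin_valP x; pose v : lcs_tvs (E n) := lin_mk xn.
  have -> : x = ind_incl E_incr v by apply: val_inj.
  have := @scale_continuous K (lcs_tvs (E n)) (0, v) (@ind_incl K V E E_incr n @^-1` U).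
  rewrite /= scale0r => /(_ (nU n))[[P Q] /= [P0 Qv] PQU].
  have /nbhs_ballP[e /= e0 eP] := P0.
  have e2 : 0 < e / 2 by rewrite divr_gt0.
  exists (e / 2) => //; rewrite -inclZ; apply: (PQU (_, v)); split => /=.
    apply: eP; rewrite -ball_normE /= sub0r normrN (gtr0_norm e2).
    by rewrite ltr_pdivrMr// ltr_pMr// ltr1n.
  exact: nbhs_singleton.
have adm : lc_admissible (@ind_incl K V E E_incr) (gauge_topology dU).
  split=> [|n v A]; first exact: gauge_locally_convex.
  move=> /gauge_nbhsP[e e0 eA].
  have nV := nbhsT v (nbhs0Z (lt0r_neq0 e0) (nU n)).
  apply: filterS nV => _ [_ [w Uw <-] <-].
  by rewrite /= inclD inclZ; exact: eA.
have : nbhs (0 : topologized (gauge_topology dU)) U.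
  by apply/gauge_nbhsP; exists 1 => // w Uw; rewrite add0r scale1r.
pose j : {t | lc_admissible (@ind_incl K V E E_incr) t} := exist _ _ adm.
have cvgj : nbhs (0 : topologized (finest_locally_convex (@ind_incl K V E E_incr))) -->
    (0 : topologized (sval j)).
  have FF := @nbhs_filter (topologized (finest_locally_convex (@ind_incl K V E E_incr))) 0.
  by move: j; apply: (iffLR (@cvg_sup_topology_on _ _ _ _ _ FF)); exact: cvg_id.
exact: (cvgj U).
Qed.

End IndLimit.

Section ProjLimit.
Context {K : numFieldType} {V : lmodType K} (E : nat -> lcs V).

Lemma proj_incl0 n : @proj_incl K V E n 0 = 0.
Proof. exact: val_inj. Qed.

Lemma proj_lim_nbhs0_preimage n (U : set (lcs_tvs (E n))) :
  nbhs 0 U -> nbhs (0 : lcs_tvs (proj_lim E)) (@proj_incl K V E n @^-1` U).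
Proof.
move=> U0.
have cvgn : nbhs (0 : topologized (proj_topology E)) -->
    (0 : topologized (topology_of (initial_topology (@proj_incl K V E n)))).
  have FF := @nbhs_filter (topologized (proj_topology E)) 0.
  by move: n {U U0}; apply: (iffLR (@cvg_sup_topology_on _ _ _ _ _ FF)); exact: cvg_id.
apply: (cvgn (@proj_incl K V E n @^-1` U)); rewrite nbhs_topology_of.
apply: initial_continuous.
by rewrite proj_incl0.
Qed.

(** For a directed spectrum one neighbourhood in one step suffices, rather than
    finitely many. *)
Lemma proj_lim_nbhs0 (U : set (lcs_tvs (proj_lim E))) :
  (forall n (A : set (lcs_tvs (E n))), nbhs 0 A ->
    exists2 B : set (lcs_tvs (E n.+1)), nbhs 0 B &
      forall u, B (proj_incl n.+1 u) -> A (proj_incl n u)) ->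
  nbhs 0 U -> exists n, exists2 A : set (lcs_tvs (E n)), nbhs 0 A &
    @proj_incl K V E n @^-1` A `<=` U.
Proof.
move=> dir U0.
have {}dir n m (A : set (lcs_tvs (E n))) : (n <= m)%N -> nbhs 0 A ->
    exists2 B : set (lcs_tvs (E m)), nbhs 0 B &
      forall u, B (proj_incl m u) -> A (proj_incl n u).
  move=> /subnKC <-; elim: (m - n)%N => [|k IH] A0.
    by rewrite addn0; exists A.
  have [B B0 BA] := IH A0; rewrite addnS; have [C C0 CB] := dir _ B B0.
  by exists C => // u /CB /BA.
pose F : set_system (lin_sort (proj_space E)) :=
  [set U | exists n, exists2 A : set (lcs_tvs (E n)), nbhs 0 A &
    @proj_incl K V E n @^-1` A `<=` U].
have FF : Filter F.
  split.
  - by exists 0%N, setT => //; exact: filterT.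
  - move=> P Q [n [A A0 AP]] [m [B B0 BQ]].
    have [A' A'0 A'A] := dir n (maxn n m) A (leq_maxl _ _) A0.
    have [B' B'0 B'B] := dir m (maxn n m) B (leq_maxr _ _) B0.
    exists (maxn n m), (A' `&` B'); first exact: filterI.
    by move=> u [/A'A/AP Pu /B'B/BQ Qu].
  - by move=> P Q PQ [n [A A0 AP]]; exists n, A => // u /AP /PQ.
suff : F --> (0 : topologized (proj_topology E)) by move=> /(_ U U0).
apply/(@cvg_sup_topology_on _ _ _ _ _ FF) => n A.
rewrite nbhs_topology_of => -[_ [[B oB <-] B0 BA]].
exists n, B => //; apply: open_nbhs_nbhs; split=> //.
by move: B0; rewrite /= proj_incl0.
Qed.

End ProjLimit.

Section LcsVal.
Context {K : numFieldType} {V : lmodType K} {E : lcs V}.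

Lemma lcs_val0 : val (0 : lcs_tvs E) = 0 :> V.
Proof. by []. Qed.

Lemma lcs_val_comb (a b : K) (u v : lcs_tvs E) :
  val (a *: u + b *: v) = a *: val u + b *: val v :> V.
Proof. by []. Qed.

Lemma lcs_valZ (a : K) (u : lcs_tvs E) : val (a *: u) = a *: val u :> V.
Proof. by []. Qed.

Lemma lcs_valD (u v : lcs_tvs E) : val (u + v) = val u + val v :> V.
Proof. by []. Qed.

Lemma disc_preimage_val (W : set V) : disc W -> disc [set v : lcs_tvs E | W (val v)].
Proof.
move=> [W0 dW]; split; first exact: W0.
by move=> a b x y ab Wx Wy; exact: (dW a b (val x) (val y)).
Qed.

Lemma disc_image_val (U : set (lcs_tvs E)) : disc U ->
  disc [set f : V | exists2 v : lcs_tvs E, val v = f & U v].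
Proof.
move=> [U0 dU]; split; first by exists 0; [exact: lcs_val0|].
move=> a b _ _ ab [x <- Ux] [y <- Uy]; exists (a *: x + b *: y).
  exact: lcs_val_comb.
exact: dU.
Qed.

End LcsVal.

(** The spaces (AC)_0 and (AC)_c are the instances F N n = C(a_{N,n})_0 and F N n = C_c. *)
Section ProjectiveSpectrum.
Context {R : realType} {s : scalars} {X : topologicalType}.
Local Notation K := (scalar_field R s).
Local Notation V := (X -> K^o).
Variables (A : weight_system R X) (F : nat -> nat -> lin_subspace V).
Hypothesis F_C0 : forall N n, lin_carrier (F N n) `<=` C0_set s (A N n).
Hypothesis F_incr : forall N n, lin_carrier (F N n) `<=` lin_carrier (F N n.+1).
Hypothesis F_decr : forall N n, lin_carrier (F N.+1 n) `<=` lin_carrier (F N n).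

Definition step N : lcs V := @ind_lim _ V (fun n => weighted_lcs (@F_C0 N n)) (@F_incr N).
Definition plb : lcs V := proj_lim step.

(** For a disc W this means that W is a neighbourhood of 0 in the N-th inductive limit. *)
Definition absorbs_balls N (W : set V) := forall n, exists2 e : R, 0 < e &
  forall f, lin_carrier (F N n) f -> dominated f (fun x => e / A N n x) -> W f.

Lemma weighted_lcs_nbhs0P (a : weight R X) (U : lin_subspace V)
    (UC0 : lin_carrier U `<=` C0_set s a) (W : set (lcs_tvs (weighted_lcs UC0))) :
  nbhs 0 W <-> exists2 e : R, 0 < e & forall f : lin_sort U,
    dominated (val f) (fun x => e / a x) -> W f.
Proof.
have -> : nbhs (0 : lcs_tvs (weighted_lcs UC0)) W = nbhs (0 : weighted_space UC0) W.
  by rewrite -[in RHS]nbhs_topology_of.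
split.
  move=> /nbhs_ballP[_ /gt0_of_real[e e0 ->] eW].
  have e2 : 0 < e / 2 by rewrite divr_gt0.
  exists (e / 2) => // f fe; apply: eW; rewrite -ball_normE /= sub0r normrN.
  change (of_real s (weighted_norm a (val f)) < of_real s e).
  rewrite of_real_lt (@le_lt_trans _ _ (e / 2))//; last by rewrite ltr_pdivrMr// ltr_pMr// ltr1n.
  apply: (@weighted_norm_le _ _ _ a U UC0 f); first exact: ltW.
  exact/dominated_weight.
move=> [e e0 eW]; apply/nbhs_ballP; exists (of_real s e); first by rewrite /= of_real_gt0.
move=> f; rewrite -ball_normE /= sub0r normrN => fe; apply: eW.
apply/dominated_weight => x; apply: le_trans (@weighted_le_norm _ _ _ a U UC0 f x) _.
by rewrite -(@of_real_le R s); exact: ltW.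
Qed.

Lemma step_nbhs0P N (U : set (lcs_tvs (step N))) :
  nbhs 0 U <-> exists W, [/\ disc W, absorbs_balls N W & forall v, W (val v) -> U v].
Proof.
split.
  move=> /nbhs0_disc[W [dW W0 WU]].
  exists [set f | exists2 v : lcs_tvs (step N), val v = f & W v]; split.
  - exact: disc_image_val.
  - move=> n; have /weighted_lcs_nbhs0P[e e0 eW] := ind_lim_nbhs0_preimage n W0.
    exists e => // f Ff fe; pose E n := weighted_lcs (@F_C0 N n).
    by exists (@ind_incl _ V E (@F_incr N) n (lin_mk Ff)) => //; exact: eW.
  - by move=> v [v' /val_inj -> Wv]; exact: WU.
move=> [W [dW bW WU]].
suff : nbhs (0 : lcs_tvs (step N)) [set v | W (val v)] by apply: filterS => v /WU.
apply: ind_lim_nbhs0; first exact: disc_preimage_val.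
move=> n; apply/weighted_lcs_nbhs0P; have [e e0 eW] := bW n.
by exists e => // f fe /=; apply: eW => //; exact: lin_valP.
Qed.

Lemma plb_nbhs0P (U : set (lcs_tvs plb)) :
  nbhs 0 U <-> exists N W, [/\ disc W, absorbs_balls N W & forall v, W (val v) -> U v].
Proof.
split.
  move=> /proj_lim_nbhs0[].
    move=> n B /step_nbhs0P[W [dW bW WB]].
    exists [set v | W (val v)]; last by move=> u Wu; exact: WB.
    apply/step_nbhs0P; exists W; split=> // m; have [e e0 eW] := bW m.
    exists e => // f Ff fe; apply: eW; first exact: F_decr.
    move=> x; apply: le_trans (fe x) _; rewrite ler_pM2l// lef_pV2 ?posrE ?weight_gt0//.
    exact: sys_incr.
  move=> N [B /step_nbhs0P[W [dW bW WB]] BU]; exists N, W; split=> // v Wv.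
  by apply: BU; exact: WB.
move=> [N [W [dW bW WU]]].
have : nbhs (0 : lcs_tvs (step N)) [set v | W (val v)].
  by apply/step_nbhs0P; exists W; split.
move=> /proj_lim_nbhs0_preimage; apply: filterS => v /=; exact: WU.
Qed.

End ProjectiveSpectrum.

(** * Cut-off functions *)

Section Bump.
Context {R : realType} {X : topologicalType}.
Hypothesis X_hausdorff : hausdorff_space X.
Hypothesis X_locally_compact : locally_compact [set: X].

Definition cutoff (C : set X) (g : X -> R) := [/\ continuous g,
  forall x, 0 <= g x <= 1, forall x, C x -> g x = 1 &
  compact (closure [set x | g x != 0])].

Lemma cutoff_nbhs (x : X) : exists2 U : set X, nbhs x U & exists g, cutoff U g.
Proof.
have [Q xQ [cQ Qcl]] := @X_locally_compact x Logic.I.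
have {}xQ : nbhs x Q.
  by have := xQ : nbhs x [set y | [set: X] y -> Q y]; apply: filterS => y; exact.
have sepQ : uniform_separator [set x] (~` Q^°).
  apply: (@locally_compact_completely_regular _ R) => //.
  by rewrite closedC; exact: open_interior.
pose f := @Urysohn X R [set x] (~` Q^°).
have fc : continuous f := @Urysohn_continuous X R _ _.
have f01 y : 0 <= f y <= 1.
  by have := @Urysohn_range X R [set x] (~` Q^°) (f y); rewrite /= in_itv/=; apply; exists y.
have fx : f x = 0 by apply: (Urysohn_sub0 sepQ); exists x.
have f1 y : ~ Q y -> f y = 1.
  by move=> nQy; apply: (Urysohn_sub1 sepQ); exists y => // /interior_subset.
exists [set y | f y < 2^-1].
  by apply: (cvgr_lt _ (fc x)); rewrite fx invr_gt0.
exists (fun y => Num.min 1 (2 * (1 - f y))); split.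
- move=> y.
  apply: (@continuous_min _ _ (fun=> 1) (fun y => 2 * (1 - f y))); first exact: cvg_cst.
  by apply: cvgM; [exact: cvg_cst|apply: cvgB; [exact: cvg_cst|exact: fc]].
- move=> y; have /andP[f0 fl] := f01 y.
  by rewrite le_min ler01 ge_min lexx mulr_ge0// subr_ge0.
- move=> y /= fy; apply/min_idPl; lra.
- apply: subclosed_compact cQ _; first exact: closed_closure.
  rewrite [X in _ `<=` X](closure_id Q).1//; apply: closureS => y /= gy0.
  apply: contrapT => /f1 fy; move: gy0; rewrite fy subrr mulr0.
  by rewrite (min_idPr _) ?ler01// eqxx.
Qed.

(** The sets admitting a cut-off form an ideal; if a compact set were not in it,
    the complements would form a filter with a cluster point. *)
Lemma compact_cutoff (C : set X) : compact C -> exists g, cutoff C g.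
Proof.
move=> cC; apply: contrapT => nC.
pose P (D : set X) := exists g, cutoff D g.
have PS D D' : D `<=` D' -> P D' -> P D.
  by move=> DD' [g [gc g01 g1 gK]]; exists g; split=> // x /DD' /g1.
have P0 : P set0.
  exists (fun=> 0); split=> //; first exact: cst_continuous.
    by move=> x; rewrite lexx ler01.
  rewrite (_ : [set _ | _] = set0) ?closure0; first exact: compact0.
  by apply/seteqP; split=> x //=; rewrite eqxx.
have PU D D' : P D -> P D' -> P (D `|` D').
  move=> [g [gc g01 g1 gK]] [h [hc h01 h1 hK]].
  exists (fun x => Num.max (g x) (h x)); split.
  - by move=> x; apply: continuous_max; [exact: gc|exact: hc].
  - by move=> x; have /andP[g0 gl] := g01 x; have /andP[h0 hl] := h01 x;
      rewrite le_max g0 ge_max gl hl.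
  - move=> x; have /andP[g0 gl] := g01 x; have /andP[h0 hl] := h01 x.
    by case=> [/g1->|/h1->]; [apply/max_idPl|apply/max_idPr].
  - apply: subclosed_compact (compactU gK hK) _; first exact: closed_closure.
    rewrite -closureU; apply: closureS => x /= ghx; apply/orP.
    apply: contraNT ghx; rewrite negb_or !negbK => /andP[/eqP-> /eqP->].
    by rewrite maxxx.
have FP : ProperFilter [set D | P (C `\` D)].
  split; first by rewrite /= setD0.
  split.
  - by rewrite /= setDT.
  - by move=> D D' /= PD PD'; rewrite setDIr; exact: PU.
  - by move=> D D' DD' /= PD; apply: PS PD; exact: setDS.
have [|x [Cx xF]] := cC _ FP; first by rewrite /= setDv.
have [U xU PU'] := cutoff_nbhs x.
have [|y [nUy Uy]] := xF (~` U) U _ xU; last exact: nUy.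
by apply: PS PU'; rewrite setDE setCK; exact: subIsetr.
Qed.

End Bump.

Section CutoffFunctions.
Context {R : realType} {s : scalars} {X : topologicalType}.
Local Notation K := (scalar_field R s).
Local Notation V := (X -> K^o).
Variable A : weight_system R X.

Lemma Cc_cutoff (C : set X) (g : X -> R) (f : V) : cutoff C g ->
  continuous (f : X -> K) -> Cc_set s (rmul g f).
Proof.
move=> [gc _ _ gK] fc; split; first exact: rmul_continuous.
apply: subclosed_compact gK _; first exact: closed_closure.
apply: closureS => x /=; apply: contraNN => /eqP gx0.
by rewrite /rmul gx0 of_real0 mul0r.
Qed.

Lemma exists_Cc_peak (X_hausdorff : hausdorff_space X)
    (X_locally_compact : locally_compact [set: X]) N n (x : X) (e : R) : 0 < e ->
  exists f : V, [/\ Cc_set s f, dominated f (fun y => e / A N n y) &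
    modulus (f x) = e / A N n x].
Proof.
move=> e0; have [g cg] :=
  @compact_cutoff R X X_hausdorff X_locally_compact _ (@compact_set1 X x).
have [_ g01 g1 _] := cg.
pose h y := e / A N n y; have h0 y : 0 < h y by rewrite divr_gt0 ?weight_gt0.
have hc : continuous h.
  by move=> y; apply: cvgM; [exact: cvg_cst|exact: (@w_continuous R X A)].
exists (rmul g (fun y => of_real s (h y))); split.
- apply: Cc_cutoff cg _ => y.
  by apply: continuous_cvg; [exact: of_real_continuous|exact: hc].
- move=> y; have /andP[gy0 gy1] := g01 y.
  rewrite modulus_rmul modulus_of_real (ger0_norm gy0) gtr0_norm//.
  by rewrite ler_piMl// ltW.
- by rewrite modulus_rmul modulus_of_real g1// normr1 mul1r gtr0_norm.
Qed.

End CutoffFunctions.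

(** * Failure of condition (wQ) *)

Lemma finite_upper_bound (R : realType) (q : nat -> R) n :
  exists2 c : R, 0 < c & forall i, (i < n)%N -> q i <= c.
Proof.
elim: n => [|n [c c0 qc]]; first by exists 1.
exists (Num.max c (q n)) => [|i]; first by rewrite lt_max c0.
by rewrite ltnS leq_eqVlt le_max => /predU1P[->|/qc->//]; rewrite lexx orbT.
Qed.

Lemma exists_natS_gt (R : realType) (r : R) : exists n : nat, r < n.+1%:R.
Proof.
exists (Num.bound `|r|); rewrite (le_lt_trans (ler_norm r))//.
by rewrite (lt_le_trans (archi_boundP (normr_ge0 r)))// ler_nat.
Qed.

Section NotwQ.
Context {R : realType} {s : scalars} {X : topologicalType}.
Local Notation K := (scalar_field R s).
Local Notation V := (X -> K^o).
Variable A : weight_system R X.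

Definition uniformly_bounded (B : set V) := forall N, exists n,
  exists2 c : R, 0 < c & forall f, B f -> dominated f (fun x => c / A N n x).

(** If (wQ) fails at N then for every j there are K_j and m_j such that w_{j,m_j} exceeds
    (k+1) max(w_{N,j}, w_{K_j,k}) at some point x_{jk}.  Put phi_{jk} = w_{j,m_j}(x_{jk}) / (k+1).
    A set bounded by multiples of w_{N,n} and of the w_{K_j,k_j} satisfies the bounds phi_{jk}
    up to a factor if j >= n or if k >= k_j, and only finitely many pairs remain. *)
Lemma not_wQ_points : ~ condition_wQ A ->
  exists (x : nat -> nat -> X) (phi : nat -> nat -> R),
  [/\ forall j k, 0 < phi j k,
      forall B, uniformly_bounded B -> exists2 c : R, 0 < c &
        forall f j k, B f -> modulus (f (x j k)) <= c * phi j k &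
      forall M, exists m, forall e : R, 0 < e ->
        exists j k, phi j k < e / A M m (x j k)].
Proof.
move=> /existsNP[N nwQ].
have {nwQ} nwQ j : exists Km : nat * nat, forall k, exists x,
    k.+1%:R * Num.max (A N j x)^-1 (A Km.1 k x)^-1 < (A j Km.2 x)^-1.
  have /forallNP/(_ j)/forallNP/(_ j)/existsNP[L /existsNP[m nx]] := nwQ.
  exists (L, m) => k; apply: contrapT => /forallNP nk; apply: nx.
  exists k, k.+1%:R => // x; rewrite leNgt; apply/negP => lt; apply: (nk x).
  by rewrite maxr_pMr.
have [Km KmP] := choice nwQ.
pose x j := projT1 (choice (KmP j)).
have xP j k : k.+1%:R * Num.max (A N j (x j k))^-1 (A (Km j).1 k (x j k))^-1 <
    (A j (Km j).2 (x j k))^-1 by exact: (projT2 (choice (KmP j)) k).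
clearbody x.
pose L j := (Km j).1; pose m j := (Km j).2.
exists x, (fun j k => k.+1%:R^-1 / A j (m j) (x j k)).
have phi0 j k : 0 < k.+1%:R^-1 / A j (m j) (x j k).
  by rewrite divr_gt0 ?weight_gt0.
have phiN j k : (A N j (x j k))^-1 <= k.+1%:R^-1 / A j (m j) (x j k).
  rewrite ler_pdivlMl//; apply: ltW; apply: le_lt_trans (xP j k).
  by rewrite ler_wpM2l// le_max lexx.
have phiL j k : (A (L j) k (x j k))^-1 <= k.+1%:R^-1 / A j (m j) (x j k).
  rewrite ler_pdivlMl//; apply: ltW; apply: le_lt_trans (xP j k).
  by rewrite ler_wpM2l// le_max lexx orbT.
split=> //.
- move=> B bB; have [n [c c0 Bc]] := bB N.
  have [n' n'P] := choice (fun j => bB (L j)).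
  have row j : exists2 d : R, 0 < d & forall f k, B f ->
      modulus (f (x j k)) <= d * (k.+1%:R^-1 / A j (m j) (x j k)).
    have [d d0 Bd] := n'P j.
    have [d' d'0 qd'] := finite_upper_bound
      (fun k => c / A N n (x j k) / (k.+1%:R^-1 / A j (m j) (x j k))) (n' j).
    exists (d + d') => [|f k Bf]; first exact: addr_gt0.
    have [n'k|kn'] := leqP (n' j) k.
      rewrite (le_trans (Bd f Bf _))//; apply: ler_pM.
      + exact: ltW.
      + by rewrite invr_ge0 ltW ?weight_gt0.
      + by rewrite lerDl ltW.
      + by rewrite (le_trans (w_incr _ _ _ n'k)).
    rewrite (le_trans (Bc f Bf _))// -ler_pdivrMr// (le_trans (qd' k kn'))//.
    by rewrite lerDr ltW.
  have [d /all_and2[d0 dP]] : {d : nat -> R & forall j, 0 < d j /\ forall f k, B f ->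
      modulus (f (x j k)) <= d j * (k.+1%:R^-1 / A j (m j) (x j k))}.
    apply: (@choice _ _ (fun j d => 0 < d /\ forall f k, B f ->
      modulus (f (x j k)) <= d * (k.+1%:R^-1 / A j (m j) (x j k)))) => j.
    by have [d] := row j; exists d.
  have [d' d'0 dd'] := finite_upper_bound d n.
  exists (c + d') => [|f j k Bf]; first exact: addr_gt0.
  have [nj|jn] := leqP n j.
    rewrite (le_trans (Bc f Bf _))//; apply: ler_pM.
    + exact: ltW.
    + by rewrite invr_ge0 ltW ?weight_gt0.
    + by rewrite lerDl ltW.
    + by rewrite (le_trans (w_incr _ _ _ nj)).
  rewrite (le_trans (dP j f k Bf))// ler_wpM2r ?(ltW (phi0 _ _))//.
  by rewrite (le_trans (dd' j jn))// lerDr ltW.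
- move=> M; exists (m M) => e e0; have [k ek] := exists_natS_gt e^-1.
  exists M, k; rewrite ltr_pM2r ?invr_gt0 ?weight_gt0//.
  by rewrite invf_plt ?posrE.
Qed.

End NotwQ.

Section Spectrum.
Context {R : realType} {s : scalars} {X : topologicalType}.
Local Notation K := (scalar_field R s).
Local Notation V := (X -> K^o).
Variables (A : weight_system R X) (F : nat -> nat -> lin_subspace V).
Hypothesis F_C0 : forall N n, lin_carrier (F N n) `<=` C0_set s (A N n).
Hypothesis F_incr : forall N n, lin_carrier (F N n) `<=` lin_carrier (F N n.+1).
Hypothesis F_decr : forall N n, lin_carrier (F N.+1 n) `<=` lin_carrier (F N n).
Hypothesis Cc_F : forall N n, Cc_set s `<=` lin_carrier (F N n).

Local Notation plb := (plb F_C0 F_incr).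

Lemma disc_pointwise_bound (I : Type) (x : I -> X) (phi : I -> R) :
  (forall i, 0 <= phi i) -> disc [set f : V | forall i, modulus (f (x i)) <= phi i].
Proof.
move=> phi0; split=> [i|a b f g ab fphi gphi i]; first by rewrite [leLHS]modulus0.
rewrite (le_trans (modulusD _ _))// !modulusZ.
have ab1 : modulus a + modulus b <= 1.
  by rewrite -(@of_real_le R s) of_realD !of_real_modulus of_real1.
apply: (@le_trans _ _ ((modulus a + modulus b) * phi i)).
  by rewrite mulrDl lerD// ler_wpM2l ?modulus_ge0.
by rewrite ler_piMl.
Qed.

(** A bounded sequence escaping every ball of the N-th step, f_n(x_n) > (n+1) w_{N,n}(x_n),
    would not be absorbed by the neighbourhood of the f with |f(x_n)| <= w_{N,n}(x_n). *)
Lemma bounded_plb (B : set (lcs_tvs plb)) : tvs_bounded B ->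
  uniformly_bounded A [set f | exists2 v, val v = f & B v].
Proof.
move=> bB N; apply: contrapT => /forallNP nB.
have {nB} nB n : exists vx : lcs_tvs plb * X, B vx.1 /\
    n.+1%:R / A N n vx.2 < modulus (val vx.1 vx.2).
  apply: contrapT => /forallNP nvx; apply: (nB n); exists n.+1%:R => // _ [v <- Bv] x.
  by rewrite leNgt; apply/negP => lt; apply: (nvx (v, x)).
have [vx /all_and2[vB vx_gt]] := choice nB.
pose x n := (vx n).2.
pose W := [set f : V | forall n, modulus (f (x n)) <= (A N n (x n))^-1].
have dW : disc W by apply: disc_pointwise_bound => n; rewrite invr_ge0 ltW ?weight_gt0.
have : nbhs (0 : lcs_tvs plb) [set v | W (val v)].
  apply/(plb_nbhs0P F_decr); exists N, W; split=> // m.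
  have [c c0 qc] := finite_upper_bound (fun n => A N n (x n) / A N m (x n)) m.
  exists (Num.max c 1)^-1 => [|f Ff fm n]; first by rewrite invr_gt0 lt_max c0.
  rewrite (le_trans (fm _))// mulrC.
  have m0 : 0 < Num.max c 1 by rewrite lt_max c0.
  rewrite ler_pdivrMr//.
  have [mn|nm] := leqP m n.
    apply: le_trans (w_incr A N (x n) mn) _.
    by rewrite ler_peMr ?invr_ge0 ?(ltW (weight_gt0 _ _))// le_max lexx orbT.
  rewrite mulrC -ler_pdivrMr ?invr_gt0 ?weight_gt0// invrK mulrC.
  by rewrite le_max qc.
move=> /bB[r0 r00 rB]; have [n rn] := exists_natS_gt (modulus r0).
have [|u Wu uv] := rB (of_real s n.+1%:R) _ _ (vB n).
  rewrite norm_of_real ger0_norm// -[r0]gtr0_norm// -of_real_modulus of_real_le.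
  exact: ltW.
have := vx_gt n; rewrite ltNge => /negP; apply.
have -> : val (vx n).1 = of_real s n.+1%:R *: val u.
  exact: etrans (congr1 val (esym uv)) (lcs_valZ _ _).
rewrite modulusZ modulus_of_real ger0_norm// ler_wpM2l//.
exact: Wu.
Qed.

Lemma plb_uniformly_bounded1 (v : lcs_tvs plb) : uniformly_bounded A [set val v].
Proof.
move=> N; have [n _ vn] := lin_valP v N Logic.I.
by exists n; have [c c0 vc] := C0_dominated (F_C0 vn); exists c => // _ ->.
Qed.

Lemma absorbs_pointwise_bound (I : Type) (x : I -> X) (phi : I -> R) (c : R)
    (B : set (lcs_tvs plb)) : 0 < c ->
    (forall v, B v -> forall i, modulus (val v (x i)) <= c * phi i) ->
  absorbs [set v : lcs_tvs plb | forall i, modulus (val v (x i)) <= phi i] B.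
Proof.
move=> c0 Bc; exists (of_real s c); first by rewrite of_real_gt0.
move=> k ck v Bv; have k0 : 0 < `|k| by rewrite (lt_le_trans _ ck) ?of_real_gt0.
have k0' : k != 0 by rewrite -normr_gt0.
exists (k^-1 *: v); last by rewrite scalerA divff// scale1r.
move=> i; rewrite (_ : val (k^-1 *: v) = k^-1 *: val v); last exact: lcs_valZ.
rewrite modulusZ modulusV.
have mk : c <= modulus k by rewrite -(@of_real_le R s) of_real_modulus.
have mk0 : 0 < modulus k by exact: lt_le_trans mk.
have vi := Bc v Bv i; have phi0 : 0 <= phi i.
  by rewrite -(pmulr_rge0 _ c0) (le_trans _ vi)// modulus_ge0.
rewrite ler_pdivrMl// (le_trans vi)//.
by rewrite ler_wpM2r.
Qed.

(** A neighbourhood of 0 contains multiples of the balls of a single step M, and each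
    multiple of one of these balls contains functions that peak above some bound
    phi_{M,k} at x_{M,k}. *)
Lemma not_wQ_not_nbhs (X_hausdorff : hausdorff_space X)
    (X_locally_compact : locally_compact [set: X]) : ~ condition_wQ A ->
  exists (x : nat * nat -> X) (phi : nat * nat -> R), [/\ forall i, 0 <= phi i,
    forall B : set (lcs_tvs plb), uniformly_bounded A [set f | exists2 v, val v = f & B v] ->
      absorbs [set v : lcs_tvs plb | forall i, modulus (val v (x i)) <= phi i] B &
    ~ nbhs (0 : lcs_tvs plb) [set v | forall i, modulus (val v (x i)) <= phi i]].
Proof.
move=> /(not_wQ_points (s := s))[x [phi [phi0 phi_abs phi_small]]].
exists (fun i => x i.1 i.2), (fun i => phi i.1 i.2); split.
- by move=> i; exact: ltW.
- move=> B /phi_abs[c c0 Bc]; apply: (absorbs_pointwise_bound c0) => v Bv i.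
  by apply: Bc; exists v.
- move=> /(plb_nbhs0P F_decr)[M [W [dW bW WU]]].
  have [m mP] := phi_small M; have [e e0 eW] := bW m.
  have [j [k jk]] := mP e e0.
  have [f [Cf fe fx]] := @exists_Cc_peak R s X A X_hausdorff X_locally_compact M m (x j k) e e0.
  have plb_f : lin_carrier (lcs_space plb) f by move=> N _; exists 0%N => //; exact: Cc_F.
  have := WU (lin_mk plb_f) (eW f (@Cc_F _ _ f Cf) fe) (j, k).
  by rewrite /= fx leNgt jk.
Qed.

End Spectrum.

(** * The space of functions with compact support *)

Section Bornological.
Context {R : realType} {s : scalars} {X : topologicalType}.
Local Notation K := (scalar_field R s).
Local Notation V := (X -> K^o).
Variable A : weight_system R X.

Lemma ACc_nbhs0P (U : set (lcs_tvs (ACc s A))) :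
  nbhs 0 U <-> exists N W, [/\ disc W,
    forall n, exists2 e : R, 0 < e & forall f, Cc_set s f ->
      dominated f (fun x => e / A N n x) -> W f & forall v, W (val v) -> U v].
Proof.
exact: (@plb_nbhs0P R s X A (fun _ _ => Cc_space s) (fun N n => @Cc_subC0 R X s (A N n))
  (fun N n => @subset_refl _ (Cc_set s)) (fun N n => @subset_refl _ (Cc_set s))).
Qed.

Lemma ACc_carrier (f : V) : Cc_set s f -> lin_carrier (lcs_space (ACc s A)) f.
Proof. by move=> Cf N _; exists 0%N. Qed.

Lemma eventually_bounded_all (f : nat -> V) : (forall L, Cc_set s (f L)) ->
  eventually_bounded A f -> uniformly_bounded A (range f).
Proof.
move=> Cf fA N; have [n [c c0 [L0 _ fL]]] := fA N.
have [d /all_and2[d0 fd]] : {d : nat -> R & forall L, 0 < d L /\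
    dominated (f L) (fun x => d L / A N n x)}.
  apply: (@choice _ _ (fun L d => 0 < d /\ dominated (f L) (fun x => d / A N n x))) => L.
  by have [d] := C0_dominated (@Cc_subC0 R X s (A N n) _ (Cf L)); exists d.
have [d' d'0 dd'] := finite_upper_bound d L0.
exists n, (c + d'); first exact: addr_gt0.
move=> _ [L _ <-] x; have [L0L|LL0] := leqP L0 L.
  by rewrite (le_trans (fL L L0L x))// ler_wpM2r ?invr_ge0 ?(ltW (weight_gt0 _ _))// lerDl ltW.
rewrite (le_trans (fd L x))// ler_wpM2r ?invr_ge0 ?(ltW (weight_gt0 _ _))//.
by rewrite (le_trans (dd' L LL0))// lerDr ltW.
Qed.

(** An eventually bounded sequence in C_c is bounded in (AC)_c, hence absorbed by every
    bornivorous disc. *)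
Lemma wQ_bornological : condition_wQ A -> bornological (lcs_tvs (ACc s A)).
Proof.
move=> wQ U acU bU.
have U0 : U 0.
  have [|r r0 rU] := bU [set 0].
    move=> V V0; exists 1 => // k _ _ ->; exists 0; last by rewrite scaler0.
    exact: nbhs_singleton.
  have [|u Uu] := rU r _ 0 erefl; first by rewrite ger0_norm ?lexx ?ltW.
  move=> /eqP; rewrite scaler_eq0 gt_eqF//= => /eqP u0.
  by rewrite -u0.
have dU := absolutely_convex_disc U0 acU.
pose W := [set f : V | exists2 v : lcs_tvs (ACc s A), val v = f & U v].
have [|M MW] := @wQ_absorbs_below R s X A W (disc_image_val dU) _ wQ.
  move=> f Cf /(eventually_bounded_all Cf) fA.
  pose g L : lcs_tvs (ACc s A) := lin_mk (ACc_carrier (Cf L)).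
  have [|r r0 rU] := bU (range g).
    move=> O /ACc_nbhs0P[N [W' [dW' bW' W'O]]].
    have [n [c c0 fc]] := fA N; have [e e0 eW'] := bW' n.
    exists (of_real s (c / e)); first by rewrite of_real_gt0 divr_gt0.
    move=> k ke _ [L _ <-]; have ce0 : 0 < c / e by rewrite divr_gt0.
    have mk : c / e <= modulus k by rewrite -(@of_real_le R s) of_real_modulus.
    have mk0 : 0 < modulus k by exact: lt_le_trans mk.
    have k0 : k != 0 by apply: contraTneq mk0 => ->; rewrite modulus0 ltxx.
    exists (k^-1 *: g L); last by rewrite scalerA divff// scale1r.
    apply: W'O; rewrite (_ : val (k^-1 *: g L) = k^-1 *: f L); last exact: lcs_valZ.
    apply: eW' => [|x]; first exact: CcZ.
    rewrite modulusZ modulusV ler_pdivrMl// (le_trans (fc _ (ex_intro2 _ _ L Logic.I erefl) x))//.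
    rewrite mulrA ler_wpM2r ?invr_ge0 ?(ltW (weight_gt0 _ _))//.
    by rewrite -ler_pdivrMr.
  have [e e0 er] := gt0_of_real r0; exists e^-1; first by rewrite invr_gt0.
  move=> L; have rr : r <= `|r| by rewrite gtr0_norm.
  have [u Uu ug] := rU r rr (g L) (ex_intro2 _ _ L Logic.I erefl).
  exists u => //; rewrite of_realV -er.
  have -> : f L = r *: val u by exact: etrans (congr1 val (esym ug)) (lcs_valZ _ _).
  by rewrite scalerA mulVf ?gt_eqF// scale1r.
apply/ACc_nbhs0P; exists M, W; split; [exact: disc_image_val|exact: MW|].
by move=> v [u /val_inj -> Uu].
Qed.

(** By bounded_plb, the pointwise bounds phi_{jk} define a bornivorous set. *)
Lemma bornological_wQ : hausdorff_space X -> locally_compact [set: X] ->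
  bornological (lcs_tvs (ACc s A)) -> condition_wQ A.
Proof.
move=> hX lX bX; apply: contrapT => nwQ.
have [x [phi [phi0 phi_abs]]] := @not_wQ_not_nbhs R s X A (fun _ _ => Cc_space s)
  (fun N n => @Cc_subC0 R X s (A N n)) (fun N n => @subset_refl _ (Cc_set s))
  (fun N n => @subset_refl _ (Cc_set s)) (fun N n => @subset_refl _ (Cc_set s)) hX lX nwQ.
apply; apply: bX.
  apply: disc_absolutely_convex.
  exact: (@disc_preimage_val _ _ (ACc s A) _ (disc_pointwise_bound x phi0)).
move=> B bB; apply: phi_abs.
exact: (@bounded_plb R s X A (fun _ _ => Cc_space s)
  (fun N n => @Cc_subC0 R X s (A N n)) (fun N n => @subset_refl _ (Cc_set s))
  (fun N n => @subset_refl _ (Cc_set s))).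
Qed.

End Bornological.

(** * The space of functions vanishing at infinity *)

Section Barrelled.
Context {R : realType} {s : scalars} {X : topologicalType}.
Local Notation K := (scalar_field R s).
Local Notation V := (X -> K^o).
Variable A : weight_system R X.
Local Notation E := (lcs_tvs (AC0 s A)).
Local Notation inAC0 := (lin_carrier (lcs_space (AC0 s A))).

Lemma AC0_nbhs0P (U : set E) :
  nbhs 0 U <-> exists N W, [/\ disc W,
    forall n, exists2 e : R, 0 < e & forall f, C0_set s (A N n) f ->
      dominated f (fun x => e / A N n x) -> W f & forall v, W (val v) -> U v].
Proof.
apply: (@plb_nbhs0P R s X A (fun N n => C0_space s (A N n)) (fun N n => @subset_refl _ _)
  (fun N n => C0_lcs_incr (sys_decr A N n))).
by move=> N n; apply: C0_lcs_incr => x; exact: sys_incr.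
Qed.

Lemma inAC0_Cc (f : V) : Cc_set s f -> inAC0 f.
Proof. by move=> Cf N _; exists 0%N => //; exact: Cc_subC0. Qed.

Lemma C0Z (a : weight R X) (k : K) (f : V) : C0_set s a f -> C0_set s a (k *: f).
Proof. by move=> Cf; rewrite -[_ *: _]addr0; apply: C0_closedP => //; exact: C0_closed0. Qed.

Lemma closed_pointwise_bound (I : Type) (x : I -> X) (phi : I -> R) :
  closed [set v : E | forall i, modulus (val v (x i)) <= phi i].
Proof.
move=> v clv i; rewrite leNgt; apply/negP => lt.
pose d := (modulus (val v (x i)) - phi i) / 2.
have d0 : 0 < d by rewrite divr_gt0// subr_gt0.
have nd : nbhs (0 : E) [set u | modulus (val u (x i)) <= d].
  apply/AC0_nbhs0P; exists 0%N, [set f | unit -> modulus (f (x i)) <= d]; split.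
  - exact: (@disc_pointwise_bound R s X unit (fun=> x i) (fun=> d)) (fun=> ltW d0).
  - move=> n; exists (d * A 0%N n (x i)) => [|f _ fd _]; first by rewrite mulr_gt0 ?weight_gt0.
    by rewrite (le_trans (fd (x i)))// mulfK ?gt_eqF ?weight_gt0.
  - by move=> u; apply.
have [w [Uw [u ud uw]]] := clv _ (nbhsT v nd).
have := Uw i; apply/negP; rewrite -ltNge.
have -> : val w (x i) = val v (x i) + val u (x i).
  have wE : val w = val v + val u :> V by rewrite -uw; exact: lcs_valD.
  by rewrite wE.
have : modulus (val v (x i)) <= modulus (val v (x i) + val u (x i)) + d.
  rewrite -{1}(addrK (val u (x i)) (val v (x i))) (le_trans (modulusD _ _))//.
  by rewrite modulusN lerD2l.
have : phi i < modulus (val v (x i)) - d by rewrite /d; lra.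
lra.
Qed.

(** The pointwise bounds phi_{jk} define a barrel: each function is bounded in all steps,
    and evaluations at points are continuous. *)
Lemma barrelled_wQ : hausdorff_space X -> locally_compact [set: X] ->
  barrelled E -> condition_wQ A.
Proof.
move=> hX lX bX; apply: contrapT => nwQ.
have [||x [phi [phi0 phi_abs]]] := @not_wQ_not_nbhs R s X A (fun N n => C0_space s (A N n))
  (fun N n => @subset_refl _ _) (fun N n => C0_lcs_incr (sys_decr A N n)) _ _ hX lX nwQ.
- by move=> N n; apply: C0_lcs_incr => y; exact: sys_incr.
- by move=> N n; exact: Cc_subC0.
apply; apply: bX; split.
- exact: closed_pointwise_bound.
- apply: disc_absolutely_convex.
  exact: (@disc_preimage_val _ _ (AC0 s A) _ (disc_pointwise_bound x phi0)).
- move=> v; apply: phi_abs.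
  have := @plb_uniformly_bounded1 R s X A (fun N n => C0_space s (A N n))
    (fun N n => @subset_refl _ _) (fun N n => C0_lcs_incr (sys_decr A N n)) v.
  move=> vb N; have [n [c c0 vc]] := vb N; exists n, c => // _ [_ <- ->].
  exact: vc.
Qed.

Section Barrel.
Variable U : set E.
Hypothesis U_barrel : barrel U.
Let W := [set f : V | exists2 v : E, val v = f & U v].

Lemma barrel0 : U 0.
Proof.
have [_ _ absU] := U_barrel; have [r r0 rU] := absU 0.
have [|u Uu] := rU r _ 0 erefl; first by rewrite gtr0_norm.
move=> /eqP; rewrite scaler_eq0 gt_eqF//= => /eqP u0.
by rewrite -u0.
Qed.

Lemma barrel_disc : disc W.
Proof.
apply: disc_image_val; have [_ acU _] := U_barrel.
exact: absolutely_convex_disc barrel0 acU.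
Qed.

Lemma barrel_of_real_le (a b : R) (f : V) : 0 <= b -> b <= a -> 0 < a ->
  W (of_real s a *: f) -> W (of_real s b *: f).
Proof.
move=> b0 ba a0 Wf.
have -> : of_real s b *: f = of_real s (b / a) *: (of_real s a *: f).
  by rewrite scalerA -of_realM divfK// gt_eqF.
apply: discZ barrel_disc _ Wf.
rewrite norm_of_real -of_real1 of_real_le ger0_norm ?ler_pdivrMr ?mul1r//.
by rewrite divr_ge0// ltW.
Qed.

Lemma barrel_absorbs1 (f : V) : inAC0 f ->
  exists2 r : R, 0 < r & W (of_real s r^-1 *: f).
Proof.
move=> Ef; have [_ _ absU] := U_barrel; have [_ /gt0_of_real[r r0 ->] rU] := absU (lin_mk Ef).
have [|u Uu uf] := rU (of_real s r) _ _ erefl.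
  by rewrite norm_of_real gtr0_norm.
exists r => //; exists u => //.
have -> : f = of_real s r *: val u.
  exact: etrans (congr1 val (esym uf)) (lcs_valZ _ _).
by rewrite scalerA -of_realM mulVf ?gt_eqF// of_real1 scale1r.
Qed.

Lemma barrel_complement (f : V) : inAC0 f -> ~ W f ->
  exists N W', [/\ disc W',
    forall n, exists2 e : R, 0 < e & forall g, C0_set s (A N n) g ->
      dominated g (fun x => e / A N n x) -> W' g &
    forall g, inAC0 g -> W' g -> ~ W (f + g)].
Proof.
move=> Ef nWf; have [clU _ _] := U_barrel; pose v : E := lin_mk Ef.
have : nbhs v (~` U).
  apply: open_nbhs_nbhs; split; first by rewrite openC.
  by move=> Uv; apply: nWf; exists v.
move=> /(nbhsB (- v)); rewrite addNr => /AC0_nbhs0P[N [W' [dW' bW' W'U]]].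
exists N, W'; split=> // g Eg W'g [u uE Uu].
have [u' nU u'g] := W'U (lin_mk Eg : E) W'g.
apply: nU; suff -> : u' = u by [].
have -> : u' = v + (lin_mk Eg : E) by rewrite -u'g addrA subrr add0r.
apply: val_inj; rewrite uE; exact: (lcs_valD v (lin_mk Eg : E)).
Qed.

(** This is Baire's argument in the span of the set D of functions below all the d_N, which
    contains the f_L.  Were the f_L not absorbed, there would be linear combinations h_j of
    them and radii delta_j, at least halved at each step, such that h_j + delta_j D does
    not meet (j+1) U and contains the next h_{j+1} + delta_{j+1} D.  The limit of the
    h_j would then not be absorbed by U. *)
Lemma barrel_absorbs_sequence (f : nat -> V) : (forall L, Cc_set s (f L)) ->
  eventually_bounded A f -> exists2 e : R, 0 < e & forall L, W (of_real s e *: f L).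
Proof.
move=> Cf /(eventually_bounded_all Cf) fA.
have [n nP] := choice fA.
have [c /all_and2[c0 fc]] : {c : nat -> R & forall N, 0 < c N /\
    forall g, range f g -> dominated g (fun x => c N / A N (n N) x)}.
  apply: (@choice _ _ (fun N c => 0 < c /\
    forall g, range f g -> dominated g (fun x => c / A N (n N) x))) => N.
  by have [c] := nP N; exists c.
pose d N x := c N / A N (n N) x.
have d0 N x : 0 < d N x by rewrite divr_gt0 ?weight_gt0.
pose D := [set g : V | forall N, C0_set s (A N (n N)) g /\ dominated g (d N)].
have DZ (t : R) g : 0 <= t -> t <= 1 -> D g -> D (of_real s t *: g).
  move=> t0 t1 Dg N; have [Cg gd] := Dg N; split; first exact: C0Z.
  move=> x; rewrite modulusZ modulus_of_real ger0_norm//.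
  by rewrite (le_trans _ (gd x))// ler_piMl ?modulus_ge0.
have D_in g : D g -> inAC0 g by move=> Dg N _; exists (n N) => //; exact: (Dg N).1.
have fD L : D (f L).
  by move=> N; split; [exact: Cc_subC0|apply: fc; exists L].
have room h : inAC0 h -> ~ W h -> exists2 e : R, 0 < e &
    forall g, D g -> ~ W (h + of_real s e *: g).
  move=> Eh /(barrel_complement Eh)[N [W' [dW' bW' W'h]]].
  have [e e0 eW'] := bW' (n N); exists (Num.min 1 (e / c N)).
    by rewrite lt_min ltr01 divr_gt0.
  move=> g Dg; have [t0 t1 te] : [/\ 0 <= Num.min 1 (e / c N), Num.min 1 (e / c N) <= 1
      & Num.min 1 (e / c N) <= e / c N].
    by rewrite le_min ler01 !ge_min !lexx orbT ltW// divr_gt0.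
  have Dtg := DZ _ g t0 t1 Dg; apply: W'h; first exact: D_in.
  apply: eW'; first exact: (Dtg N).1.
  move=> x; rewrite modulusZ modulus_of_real ger0_norm//.
  have [_ gd] := Dg N; rewrite (le_trans (ler_wpM2l t0 (gd x)))//.
  by rewrite /d mulrA ler_wpM2r ?invr_ge0 ?(ltW (weight_gt0 _ _))// -ler_pdivlMr.
apply: contrapT => nf.
have {}nf e : 0 < e -> exists L, ~ W (of_real s e *: f L).
  move=> e0; apply: contrapT => /forallNP nL; apply: nf; exists e => // L.
  exact: contrapT (nL L).
(* states are triples (j, h_j, delta_j) *)
pose avoids (p : nat * V * R) := [/\ Cc_set s p.1.2, 0 < p.2 & forall g, D g ->
  ~ W (of_real s (p.1.1.+1%:R)^-1 *: (p.1.2 + of_real s p.2 *: g))].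
pose state := {p | avoids p}.
pose next (p q : state) := [/\ (sval q).1.1 = (sval p).1.1.+1,
  (sval q).2 <= (sval p).2 / 2 & forall N,
  dominated ((sval q).1.2 - (sval p).1.2) (fun x => (sval p).2 / 2 * d N x)].
have nextP p : {q | next p q}.
  apply: cid; case: p => -[[j h] e] /= [/= Ch e0 avoid].
  have e2 : 0 < e / 2 by rewrite divr_gt0.
  have [r r0 Wh] := barrel_absorbs1 (inAC0_Cc Ch).
  pose j2 : R := j.+2%:R; have j20 : 0 < j2 by rewrite ltr0n.
  have j2n : j2 != 0 by rewrite gt_eqF.
  have rn : r != 0 by rewrite gt_eqF.
  have jr : j2 + r != 0 by rewrite gt_eqF// addr_gt0.
  have [L nWL] : exists L, ~ W (of_real s j2^-1 *: (h + of_real s (e / 2) *: f L)).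
    have [L nfL] := nf (e / 2 / (j2 + r)) (divr_gt0 e2 (addr_gt0 j20 r0)).
    exists L => WL; apply: nfL.
    have := barrel_disc.2 (of_real s (j2 / (j2 + r))) (of_real s (- (r / (j2 + r)))) _ _ _ WL Wh.
    have q1 : 0 <= j2 / (j2 + r) by rewrite ltW// divr_gt0// addr_gt0.
    have q2 : 0 <= r / (j2 + r) by rewrite ltW// divr_gt0// addr_gt0.
    rewrite !norm_of_real normrN (ger0_norm q1) (ger0_norm q2).
    rewrite -of_realD -mulrDl divff ?of_real1; last by rewrite gt_eqF// addr_gt0.
    move=> /(_ (lexx _)); rewrite !scalerDr !scalerA -!of_realM addrAC -scalerDl -of_realD.
    rewrite (_ : j2 / (j2 + r) / j2 + - (r / (j2 + r)) / r = 0).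
      rewrite of_real0 scale0r add0r; congr (W (of_real s _ *: _)).
      by move: (j2) jr j2n => a ar a0; field; rewrite ar a0.
    by move: (j2) jr j2n => a ar a0; field; rewrite ?ar ?a0 ?rn.
  pose h' : V := h + of_real s (e / 2) *: f L.
  have Ch' : Cc_set s h' by apply: CcD => //; exact: CcZ.
  have [e1 e10 e1W] := room _ (inAC0_Cc (CcZ (of_real s j2^-1) Ch')) nWL.
  pose e' := Num.min (e / 2) e1; have e'0 : 0 < e' by rewrite lt_min e2.
  have avoid' : avoids (j.+1, h', e').
    split=> //= g Dg; rewrite -/j2.
    have -> : of_real s j2^-1 *: (h' + of_real s e' *: g) =
        of_real s j2^-1 *: h' + of_real s e1 *: (of_real s (e' / (j2 * e1)) *: g).
      rewrite scalerDr !scalerA -!of_realM; congr (_ + of_real s _ *: _).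
      by field; rewrite !gt_eqF.
    apply: e1W; apply: DZ => //; first by rewrite divr_ge0 ?mulr_ge0 ?ltW.
    rewrite ler_pdivrMr ?mulr_gt0// mul1r; apply: (@le_trans _ _ e1).
      by rewrite ge_min lexx orbT.
    by rewrite ler_peMl ?(ltW e10)// ler1n.
  exists (exist _ _ avoid'); split=> //=; first by rewrite ge_min lexx.
  move=> N x; rewrite /h' addrAC subrr add0r modulusZ modulus_of_real ger0_norm ?(ltW e2)//.
  by rewrite ler_wpM2l ?(ltW e2)//; exact: (fD L N).2.
have [L0 nWL0] := nf 1 ltr01.
have [e1 e10 e1W] := room (f L0) (inAC0_Cc (Cf L0)) ltac:(by rewrite of_real1 scale1r in nWL0).
have avoid0 : avoids (0%N, f L0, e1).
  by split=> //= g Dg; rewrite invr1 of_real1 scale1r; exact: e1W.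
have [p [p0 /all_and3[p_idx p_le p_dist]]] := dependent_choice nextP (exist _ _ avoid0).
pose h j := (sval (p j)).1.2; pose e j := (sval (p j)).2.
have idxE j : (sval (p j)).1.1 = j.
  by elim: j => [|j IH]; [rewrite p0|rewrite p_idx IH].
have Ch j : Cc_set s (h j) by have [] := svalP (p j).
have e0 j : 0 < e j by have [] := svalP (p j).
have avoid j g : D g -> ~ W (of_real s (j.+1%:R)^-1 *: (h j + of_real s (e j) *: g)).
  by have [_ _] := svalP (p j); rewrite idxE; exact.
have e_lim : e @ \oo --> (0 : R).
  have e_geo j : e j <= e 0%N * 2^-1 ^+ j.
    elim: j => [|j IH]; first by rewrite mulr1.
    by rewrite (le_trans (p_le j))// exprSr mulrA ler_wpM2r ?invr_ge0.
  apply: (@squeeze_cvgr _ _ _ _ (fun=> 0) (fun j => e 0%N * 2^-1 ^+ j)).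
  - by apply: nearW => j; rewrite (ltW (e0 j)) e_geo.
  - exact: cvg_cst.
  - rewrite -[X in _ --> X](mulr0 (e 0%N)); apply: cvgM; first exact: cvg_cst.
    by apply: cvg_expr; rewrite ger0_norm ?invr_ge0// invf_lt1// ltr1n.
have h_dist N i j x : (i <= j)%N -> modulus (h i x - h j x) <= e i * d N x.
  move=> ij; apply: (@le_trans _ _ ((e i - e j) * d N x)); last first.
    by rewrite ler_wpM2r ?(ltW (d0 N x))// gerBl (ltW (e0 j)).
  elim: j ij => [|j IH]; first by rewrite leqn0 => /eqP->; rewrite !subrr modulus0 mul0r.
  rewrite leq_eqVlt => /predU1P[->|/IH ij]; first by rewrite !subrr modulus0 mul0r.
  rewrite -(subrK (h j x) (h i x)) -addrA (le_trans (modulusD _ _))//.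
  rewrite -(subrK (e j) (e i)) -addrA mulrDl lerD// modulusBC.
  rewrite (le_trans (p_dist j N x))// ler_wpM2r ?(ltW (d0 N x))//.
  by have := p_le j; rewrite -/(e j) -/(e j.+1) => le; rewrite lerBrDr; lra.
have [l lP] : exists l : V, forall N j x, modulus (h j x - l x) <= e j * d N x.
  suff [l lP] : {l : X -> K & forall x j N, modulus (h j x - l x) <= e j * d N x}.
    by exists l => N j x; exact: lP.
  apply: (@choice _ _ (fun x l => forall j N, modulus (h j x - l) <= e j * d N x)) => x.
  (* the infimum makes the pointwise limit satisfy the bounds for all N at once *)
  pose i := inf (range (fun N => d N x)).
  have id N : i <= d N x.
    apply: ge_inf; last by exists N.
    by exists 0 => _ [N' _ <-]; exact: ltW.
  have [||l ll] := @modulus_complete R s (fun j => h j x) (fun j => e j * i).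
  - by rewrite -[0](mul0r i); apply: cvgM => //; exact: cvg_cst.
  - move=> j k jk; rewrite mulrC -ler_pdivrMr//; apply: lb_le_inf.
      by exists (d 0%N x), 0%N.
    by move=> _ [N _ <-]; rewrite ler_pdivrMr// mulrC; exact: h_dist.
  by exists l => j N; rewrite (le_trans (ll j))// ler_wpM2l ?(ltW (e0 j)).
have e_small (r : R) : 0 < r -> exists j, e j < r.
  move=> r0; have [j _ je] : \forall j \near \oo, e j < r by exact: cvgr_lt e_lim _ r0.
  by exists j; exact: (je j (leqnn j)).
have lc : continuous (l : X -> K).
  move=> x; apply/cvg_modulusP => r r0.
  pose M := d 0%N x + 1; have M0 : 0 < M by rewrite addr_gt0.
  have r3 : 0 < r / 3 by rewrite divr_gt0.
  have [j ej] := e_small (r / 3 / M) (divr_gt0 r3 M0).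
  have ejM : e j * M < r / 3 by rewrite -ltr_pdivlMr.
  have dc : d 0%N y @[y --> x] --> d 0%N x.
    by apply: cvgM; [exact: cvg_cst|exact: (@w_continuous R X A)].
  have hc : h j y @[y --> x] --> h j x by have [hc _] := Ch j; exact: hc.
  near=> y.
  have ly : modulus (h j y - l y) <= e j * M.
    rewrite (le_trans (lP 0%N j y))// ler_wpM2l ?(ltW (e0 j))// ltW//.
    by near: y; apply: (cvgr_lt _ dc); rewrite ltrDl.
  have lx : modulus (l x - h j x) <= e j * M.
    rewrite modulusBC (le_trans (lP 0%N j x))// ler_wpM2l ?(ltW (e0 j))//.
    by rewrite /M lerDl.
  have hxy : modulus (h j x - h j y) < r / 3.
    by near: y; move: r3; move: (r / 3); exact/cvg_modulusP.
  have -> : l x - l y = (l x - h j x) + (h j x - h j y) + (h j y - l y).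
    by rewrite !addrA !subrK.
  have := modulusD (l x - h j x + (h j x - h j y)) (h j y - l y).
  have := modulusD (l x - h j x) (h j x - h j y).
  lra.
have l_C0 N : C0_set s (A N (n N)) l.
  split=> // r r0; have r2 : 0 < r / 2 by rewrite divr_gt0.
  have [j ej] := e_small (r / 2 / c N) (divr_gt0 r2 (c0 N)).
  have [_ hv] := Cc_subC0 (A N (n N)) (Ch j); have [C cC hC] := hv _ r2.
  exists C => // x /hC; rewrite !ger0_norm ?weighted_ge0// => hx.
  have -> : l = h j + (l - h j) by rewrite addrC subrK.
  rewrite (le_lt_trans (weightedD _ _ _ _))// (splitr r) ltr_leD//.
  have lh : dominated (l - h j) (fun x => e j * c N / A N (n N) x).
    by move=> y; rewrite -mulrA -/(d N y) [modulus _]modulusBC; exact: lP.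
  rewrite (le_trans (iffLR (dominated_weight _ _ _) lh x))//.
  by rewrite -ler_pdivlMr// ltW.
have l_in : inAC0 l by move=> N _; exists (n N) => //; exact: l_C0.
have [r r0 Wl] := barrel_absorbs1 l_in.
have [j rj] := exists_natS_gt r.
apply: (avoid j (of_real s (e j)^-1 *: (l - h j))).
  move=> N; split.
    apply: C0Z; have := C0_closedP (-1) (Cc_subC0 (A N (n N)) (Ch j)) (l_C0 N).
    by rewrite scaleN1r addrC.
  move=> x; rewrite modulusZ modulus_of_real ger0_norm ?invr_ge0 ?(ltW (e0 j))//.
  by rewrite ler_pdivrMl// [modulus _]modulusBC; exact: lP.
rewrite scalerA -of_realM divff ?gt_eqF// of_real1 scale1r addrC subrK.
apply: barrel_of_real_le Wl => //; rewrite ?invr_ge0 ?invr_gt0//.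
by rewrite lef_pV2 ?posrE// ltW.
Unshelve. all: by end_near. Qed.

End Barrel.
End Barrelled.

Section WQBarrelled.
Context {R : realType} {s : scalars} {X : topologicalType}.
Local Notation K := (scalar_field R s).
Local Notation V := (X -> K^o).
Variable A : weight_system R X.

(** The barrel absorbs the functions of C_c in all the balls of some step M.  The functions
    all of whose truncations are in U form a neighbourhood of 0 in this step; those that
    belong to (AC)_0 are limits of their truncations, hence in the closed set U. *)
Lemma wQ_barrelled : hausdorff_space X -> locally_compact [set: X] ->
  condition_wQ A -> barrelled (lcs_tvs (AC0 s A)).
Proof.
move=> hX lX wQ U bU.
pose W := [set f : V | exists2 v : lcs_tvs (AC0 s A), val v = f & U v].
have dW : disc W := barrel_disc bU.
have [M MW] := wQ_absorbs_below dW (barrel_absorbs_sequence bU) wQ.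
pose W' := [set f : V | forall C g, cutoff C g -> W (rmul g f)].
apply/AC0_nbhs0P; exists M, W'; split.
- split=> [C h ch|a b f g ab Wf Wg C h ch].
    rewrite (_ : rmul h 0 = 0); first exact: dW.1.
    by apply/funext => x; exact: mulr0.
  rewrite (_ : rmul h (a *: f + b *: g) = a *: rmul h f + b *: rmul h g).
    by apply: dW.2 => //; [exact: Wf ch|exact: Wg ch].
  apply/funext => x; change (of_real s (h x) * (a * f x + b * g x) =
    a * (of_real s (h x) * f x) + b * (of_real s (h x) * g x)).
  by rewrite mulrDr !(mulrCA (of_real s _)).
- move=> n; have [e e0 eW] := MW n; exists e => // f [fc _] fe C g cg.
  apply: eW; first exact: Cc_cutoff cg fc.
  have [_ g01 _ _] := cg.
  move=> x; have /andP[g0 g1] := g01 x; rewrite modulus_rmul ger0_norm//.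
  by rewrite (le_trans _ (fe x))// ler_piMl ?modulus_ge0.
move=> v W'v; apply: contrapT => nUv.
have vE : lin_carrier (lcs_space (AC0 s A)) (val v) := lin_valP v.
have nWv : ~ W (val v) by move=> [u /val_inj ->].
have [N [B [_ bB Bv]]] := barrel_complement bU vE nWv.
have [n _ vn] := vE N Logic.I; have [e e0 eB] := bB n.
have [vc v_small] := vn; have [C cC Cv] := v_small e e0.
have [g cg] := @compact_cutoff R X hX lX _ cC; have [gc g01 g1 _] := cg.
have Cgv : Cc_set s (rmul g (val v)) := Cc_cutoff cg vc.
have gvE : lin_carrier (lcs_space (AC0 s A)) (rmul g (val v) - val v).
  by have := lin_closedP (-1) vE (inAC0_Cc A Cgv); rewrite scaleN1r addrC.
have gvN : C0_set s (A N n) (rmul g (val v) - val v).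
  by have := C0_closedP (-1) vn (Cc_subC0 (A N n) Cgv); rewrite scaleN1r addrC.
suff gvB : B (rmul g (val v) - val v).
  by apply: (Bv _ gvE gvB); rewrite addrC subrK; exact: W'v cg.
apply: eB => //; apply/dominated_weight => x.
have -> : weighted (A N n) (rmul g (val v) - val v) x =
    (1 - g x) * weighted (A N n) (val v) x.
  rewrite /weighted mulrCA; congr (_ * _).
  rewrite (_ : (rmul g (val v) - val v) x = of_real s (g x - 1) * val v x).
    by rewrite modulusM modulus_of_real distrC ger0_norm// subr_ge0; have /andP[] := g01 x.
  by rewrite of_realB of_real1 mulrBl mul1r.
have [Cx|/Cv] := pselect (C x); first by rewrite g1// subrr mul0r ltW.
rewrite ger0_norm ?weighted_ge0// => /ltW; apply: le_trans.
by rewrite ler_piMl ?weighted_ge0// gerBl; have /andP[] := g01 x.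
Qed.

End WQBarrelled.

(** * The equivalence *)

Theorem proposition3p1 (R : realType) (s : scalars) (X : topologicalType)
    (X_hausdorff : hausdorff_space X)
    (X_locally_compact : locally_compact [set: X])
    (X_sigma_compact : sigma_compact X)
    (A : weight_system R X) :
  (condition_wQ A <-> bornological (lcs_tvs (ACc s A))) /\
  (condition_wQ A <-> barrelled (lcs_tvs (AC0 s A))).
Proof.
split; split.
- exact: wQ_bornological.
- exact: bornological_wQ.
- exact: wQ_barrelled.
- exact: barrelled_wQ.
Qed.
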